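(* Let $p$ be a probability density on $\mathbb{R}^n$ (the data distribution) with $p\in\mathcal{C}^2$ and $\mathbb{E}_{x\sim p}[\|x\|_2^2]<\infty$. Let $\gamma:[0,1]\to(0,\infty)$ be continuous, and put $h(x,t):=-\tfrac12\gamma(t)x$, $g(t):=\sqrt{\gamma(t)}$, $\alpha_t:=e^{-\int_0^t\gamma(s)\,ds}$. Let $\{\mathbf{x}_t\}_{t\in[0,1]}$ be the diffusion process $d\mathbf{x}=h(\mathbf{x},t)\,dt+g(t)\,dw$ with $\mathbf{x}_0\sim p$, and let $\{\hat{\mathbf{x}}_t\}_{t\in[0,1]}$ be the associated reverse process, assuming the regularity conditions on $h$ and $g$ listed in the context. Let $t\in(0,1]$, let $x_a\in\mathbb{R}^n$, and set $x_{a,t}:=\sqrt{\alpha_t}\,x_a$. Then solving the reverse-time SDE starting from time $t$ and the point $x_{a,t}$ generates a random variable $\hat{\mathbf{x}}_0$ whose density satisfies, as a function of $x\in\mathbb{R}^n$, $$\mathbb{P}\left(\hat{\mathbf{x}}_0=x\mid\hat{\mathbf{x}}_t=x_{a,t}\right)\ \propto\ p(x)\cdot\frac{1}{\sqrt{(2\pi\sigma_t^2)^n}}\exp\left(\frac{-\|x-x_a\|_2^2}{2\sigma_t^2}\right),$$ where $\sigma_t^2=\frac{1-\alpha_t}{\alpha_t}$, and the constant of proportionality does not depend on $x$.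
   Context: Forward process: the SDE $d\mathbf{x}=h(\mathbf{x},t)\,dt+g(t)\,dw$, where $w$ is a standard Wiener process in $\mathbb{R}^n$ and $\mathbf{x}_0\sim p$; write $p_t$ for the density of $\mathbf{x}_t$. With $h(x,t)=-\tfrac12\gamma(t)x$ and $g(t)=\sqrt{\gamma(t)}$, where $\gamma:[0,1]\to(0,\infty)$ is continuous, and with $\alpha_t=e^{-\int_0^t\gamma(s)\,ds}$ and $\sigma_t^2=\frac{1-\alpha_t}{\alpha_t}$, one has $\mathbf{x}_t=\sqrt{\alpha_t}\,\mathbf{x}_0+\sqrt{1-\alpha_t}\,\boldsymbol{\epsilon}$ with $\boldsymbol{\epsilon}\sim\mathcal{N}(0,I)$ independent of $\mathbf{x}_0$; equivalently $\mathbf{x}_t=\sqrt{\alpha_t}(\mathbf{x}_0+\boldsymbol{\epsilon}_t)$ with $\boldsymbol{\epsilon}_t\sim\mathcal{N}(0,\sigma_t^2I)$. Reverse process: the reverse-time SDE $d\hat{\mathbf{x}}=[h(\hat{\mathbf{x}},t)-g(t)^2\nabla_{\hat{\mathbf{x}}}\log p_t(\hat{\mathbf{x}})]\,dt+g(t)\,d\overline{w}$, where $dt$ is an infinitesimal reverse time step and $\overline{w}$ is a reverse-time standard Wiener process. It is a standing fact/convention that, under the regularity conditions listed in the next paragraph, the reverse process exists and $\{\hat{\mathbf{x}}_t\}_{t\in[0,1]}$ follows the same distribution (as a process) as $\{\mathbf{x}_t\}_{t\in[0,1]}$. Regularity conditions: $p\in\mathcal{C}^2$ with finite second moment; $h(\cdot,t)\in\mathcal{C}^1$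 for all $t$, and there is $C>0$ with $\|h(x,t)\|_2\le C(1+\|x\|_2)$ for all $x,t$; there is $C>0$ with $\|h(x,t)-h(y,t)\|_2\le C\|x-y\|_2$ for all $x,y,t$; $g$ is continuous and $|g(t)|>0$ for all $t$. Notation: $\mathbb{P}(\hat{\mathbf{x}}_0=x\mid\hat{\mathbf{x}}_t=y)$ denotes the conditional density of $\hat{\mathbf{x}}_0$ at $x$ given $\hat{\mathbf{x}}_t=y$ (joint density of $(\hat{\mathbf{x}}_0,\hat{\mathbf{x}}_t)$ at $(x,y)$ divided by the density of $\hat{\mathbf{x}}_t$ at $y$). The random variable generated by solving the reverse-time SDE from time $t$ and point $y$ is $\hat{\mathbf{x}}_0$ under this conditional law. *)

(* Defs.v *)
From HB Require Import structures.
From mathcomp Require Import all_boot all_order all_algebra.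
From mathcomp Require Import all_classical all_reals all_analysis.
Set Implicit Arguments.
Unset Strict Implicit.
Unset Printing Implicit Defensive.
Import Order.TTheory GRing.Theory Num.Theory.
Import numFieldNormedType.Exports.
Local Open Scope classical_set_scope.
Local Open Scope ring_scope.

(** Real n-space is ['rV[R]_n]: its library topology is the usual one, but its
    library norm is the sup norm, hence the separate Euclidean norm. *)

Definition norm2 (R : realType) (n : nat) (x : 'rV[R]_n) : R :=
  Num.sqrt (\sum_(i < n) x 0 i ^+ 2).

Definition borel_rV (R : realType) (n : nat) : set (set 'rV[R]_n) :=
  <<s @open 'rV[R]_n >>.

(** Integral with respect to n-dimensional Lebesgue measure, as an iterated
    integral.  It is only used on nonnegative Borel functions, for which this
    is Tonelli's theorem. *)
Fixpoint integral_rV (R : realType) (n : nat) :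
    ('rV[R]_n -> \bar R) -> \bar R :=
  match n with
  | 0 => fun f => f 0
  | m.+1 => fun f =>
      (\int[@lebesgue_measure R]_(a in setT)
         integral_rV (fun v : 'rV[R]_m => f (row_mx (const_mx a : 'rV[R]_1) v)))%E
  end.

(** In finite dimension, having continuous directional derivatives in all
    directions is the same as being continuously differentiable. *)
Definition C1 (R : realType) (V : normedModType R) (n : nat)
    (f : 'rV[R]_n -> V) : Prop :=
  forall v : 'rV[R]_n,
    (forall x, derivable f x v) /\ continuous (fun x => 'D_v f x).

Definition C2 (R : realType) (n : nat) (f : 'rV[R]_n -> R^o) : Prop :=
  C1 f /\ forall v : 'rV[R]_n, C1 (fun x => 'D_v f x : R^o).

Definition probability_density (R : realType) (n : nat)
    (p : 'rV[R]_n -> R) : Prop :=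
  (forall x, 0 <= p x) /\ integral_rV (fun x => (p x)%:E) = 1%E.

Definition finite_second_moment (R : realType) (n : nat)
    (p : 'rV[R]_n -> R) : Prop :=
  (integral_rV (fun x => (norm2 x ^+ 2 * p x)%:E) < +oo)%E.

Definition regular_coefficients (R : realType) (n : nat)
    (h : 'rV[R]_n -> R -> 'rV[R]_n) (g : R -> R) : Prop :=
  [/\ forall t, t \in `[0, 1] -> C1 (fun x => h x t),
      exists2 C : R, 0 < C & forall x t, t \in `[0, 1] ->
        norm2 (h x t) <= C * (1 + norm2 x),
      exists2 C : R, 0 < C & forall x y t, t \in `[0, 1] ->
        norm2 (h x t - h y t) <= C * norm2 (x - y),
      {within `[0, 1], continuous g} &
      forall t, t \in `[0, 1] -> 0 < `|g t| ].

(** [continuous_density P X f]: [f] is a continuous density of the law of [X].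
    A density is a priori unique only up to null sets; the continuous one, when
    it exists, is unique, and gives a meaning to pointwise values. *)
Definition continuous_density (R : realType) (d : measure_display)
    (T : measurableType d) (P : probability T R) (n : nat)
    (X : T -> 'rV[R]_n) (f : 'rV[R]_n -> R) : Prop :=
  [/\ forall x, 0 <= f x, continuous f &
      forall A, borel_rV A ->
        P (X @^-1` A) = integral_rV (fun x => (f x * \1_A x)%:E) ].

(** The continuous density of [X] (the zero function if there is none). *)
Definition density (R : realType) (d : measure_display)
    (T : measurableType d) (P : probability T R) (n : nat)
    (X : T -> 'rV[R]_n) : 'rV[R]_n -> R :=
  xget (fun=> 0) [set f | continuous_density P X f].

Definition has_density (R : realType) (d : measure_display)
    (T : measurableType d) (P : probability T R) (n : nat)
    (X : T -> 'rV[R]_n) : Prop :=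
  exists f, continuous_density P X f.

Definition joint (R : realType) (T : Type) (m n : nat)
    (X : T -> 'rV[R]_m) (Y : T -> 'rV[R]_n) : T -> 'rV[R]_(m + n) :=
  fun w => row_mx (X w) (Y w).

(** Conditional density of [X] at [x] given [Y = y]. *)
Definition cond_density (R : realType) (d : measure_display)
    (T : measurableType d) (P : probability T R) (m n : nat)
    (X : T -> 'rV[R]_m) (Y : T -> 'rV[R]_n) (x : 'rV[R]_m) (y : 'rV[R]_n) : R :=
  density P (joint X Y) (row_mx x y) / density P Y y.

(** Density at [x] of the Gaussian law with mean [m] and covariance [v I]. *)
Definition gaussian (R : realType) (n : nat) (m : 'rV[R]_n) (v : R)
    (x : 'rV[R]_n) : R :=
  (Num.sqrt ((2 * pi * v) ^+ n))^-1 * expR (- norm2 (x - m) ^+ 2 / (2 * v)).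

(** Processes and filtrations are indexed by [R] but only considered on
    [[0, 1]]. *)

Definition filtration (R : realType) (d : measure_display)
    (T : measurableType d) (F : R -> set (set T)) : Prop :=
  [/\ forall t, t \in `[0, 1] -> sigma_algebra setT (F t),
      forall t, t \in `[0, 1] -> F t `<=` measurable &
      forall s t, s \in `[0, 1] -> t \in `[0, 1] -> s <= t -> F s `<=` F t ].

Definition adapted (R : realType) (T : Type) (n : nat)
    (F : R -> set (set T)) (X : R -> T -> 'rV[R]_n) : Prop :=
  forall t, t \in `[0, 1] -> forall A, borel_rV A -> F t (X t @^-1` A).

Definition continuous_paths (R : realType) (d : measure_display)
    (T : measurableType d) (P : probability T R) (n : nat)
    (X : R -> T -> 'rV[R]_n) : Prop :=
  {ae P, forall w, {within `[0, 1], continuous (fun t => X t w)}}.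

(** Standard n-dimensional Wiener process with respect to the filtration [F]. *)
Definition wiener (R : realType) (d : measure_display)
    (T : measurableType d) (P : probability T R) (n : nat)
    (F : R -> set (set T)) (W : R -> T -> 'rV[R]_n) : Prop :=
  [/\ filtration F, adapted F W, continuous_paths P W,
      {ae P, forall w, W 0 w = 0} &
      forall s t, s \in `[0, 1] -> t \in `[0, 1] -> s < t ->
        let dW := fun w => W t w - W s w in
        continuous_density P dW (gaussian 0 (t - s)) /\
        forall E A, F s E -> borel_rV A ->
          P (E `&` dW @^-1` A) = (P E * P (dW @^-1` A))%E ].

(** The Ito integral of [g] against [W] over [[s, t]].  The integrand being
    deterministic and continuous, it is the limit in probability of the
    left-endpoint Riemann sums. *)
Definition ito_sum (R : realType) (T : Type) (n : nat)
    (g : R -> R) (W : R -> T -> 'rV[R]_n) (s t : R) (N : nat) (w : T) :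
    'rV[R]_n :=
  let u (k : nat) := s + k%:R * (t - s) / N.+1%:R in
  \sum_(k < N.+1) g (u k) *: (W (u k.+1) w - W (u k) w).

Definition ito_integral (R : realType) (d : measure_display)
    (T : measurableType d) (P : probability T R) (n : nat)
    (g : R -> R) (W : R -> T -> 'rV[R]_n) (s t : R) (I : T -> 'rV[R]_n) : Prop :=
  (forall A, borel_rV A -> measurable (I @^-1` A)) /\
  forall e : R, 0 < e ->
    (fun N => P [set w | e <= norm2 (ito_sum g W s t N w - I w)]) @ \oo --> 0%E.

(** [X] solves [dX = b(X, t) dt + g(t) dW] at the times in [J], a
    subinterval of [[0, 1]], for the filtration [F]. *)
Definition sde_solution (R : realType) (d : measure_display)
    (T : measurableType d) (P : probability T R) (n : nat) (J : interval R)
    (F : R -> set (set T)) (W : R -> T -> 'rV[R]_n)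
    (b : 'rV[R]_n -> R -> 'rV[R]_n) (g : R -> R) (X : R -> T -> 'rV[R]_n) :
    Prop :=
  [/\ wiener P F W, adapted F X, continuous_paths P X &
      forall s t, s \in J -> t \in J -> s <= t ->
        {ae P, forall w, forall i : 'I_n,
          (@lebesgue_measure R).-integrable `[s, t]
            (fun u => (b (X u w) u 0 i)%:E)} /\
        exists2 I, ito_integral P g W s t I &
          {ae P, forall w, X t w = X s w
            + \row_(i < n) \int[@lebesgue_measure R]_(u in `[s, t])
                (b (X u w) u 0 i)
            + I w} ].

(** Gradient of the logarithm of [q]. *)
Definition score (R : realType) (n : nat) (q : 'rV[R]_n -> R) (x : 'rV[R]_n) :
    'rV[R]_n :=
  \row_(i < n) 'D_(delta_mx 0 i) (fun y => ln (q y) : R^o) x.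

(** Same law as processes on [[0, 1]]: equal finite-dimensional laws. *)
Definition same_law (R : realType) (n : nat)
    (d : measure_display) (T : measurableType d) (P : probability T R)
    (X : R -> T -> 'rV[R]_n)
    (d' : measure_display) (T' : measurableType d') (P' : probability T' R)
    (Y : R -> T' -> 'rV[R]_n) : Prop :=
  forall (k : nat) (t : 'I_k -> R) (A : 'I_k -> set 'rV[R]_n),
    (forall i, t i \in `[0, 1]) -> (forall i, borel_rV (A i)) ->
    P (\bigcap_(i in [set: 'I_k]) X (t i) @^-1` A i) =
    P' (\bigcap_(i in [set: 'I_k]) Y (t i) @^-1` A i).

(** The forward diffusion [dx = h(x, t) dt + g(t) dw] with initial density
    [p]. *)
Definition forward_process (R : realType) (d : measure_display)
    (T : measurableType d) (P : probability T R) (n : nat)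
    (p : 'rV[R]_n -> R) (h : 'rV[R]_n -> R -> 'rV[R]_n) (g : R -> R)
    (F : R -> set (set T)) (W X : R -> T -> 'rV[R]_n) : Prop :=
  continuous_density P (X 0) p /\ sde_solution P `[0, 1] F W h g X.

(** [Y] solves the reverse-time equation
    [dy = (h(y, t) - g(t)^2 grad log p_t(y)) dt + g(t) dWb], with [p_t] the
    density of [X t], that is, with the clock [s = 1 - t],
    [s |-> Y (1 - s)] solves a forward equation whose drift has the opposite
    sign.  The time [t = 0] ([s = 1]) is left out of the equation, because
    [log p_0] need not be finite; [Y 0] is then given by continuity of paths.
    That [Y] has the law of [X] is part of the notion of reverse process. *)
Definition reverse_process (R : realType) (n : nat)
    (d : measure_display) (T : measurableType d) (P : probability T R)
    (h : 'rV[R]_n -> R -> 'rV[R]_n) (g : R -> R) (X : R -> T -> 'rV[R]_n)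
    (d' : measure_display) (T' : measurableType d') (P' : probability T' R)
    (G : R -> set (set T')) (Wb Y : R -> T' -> 'rV[R]_n) : Prop :=
  sde_solution P' `[0, 1[
    (fun s => G (1 - s)) (fun s => Wb (1 - s))
    (fun y s => - (h y (1 - s)
                   - g (1 - s) ^+ 2 *: score (density P (X (1 - s))) y))
    (fun s => g (1 - s))
    (fun s => Y (1 - s)) /\
  same_law P X P' Y.

(* Main.v *)
(** Only the law of [(X 0, X t)] matters, because the reverse process has the
    same finite-dimensional laws as the forward one.  With
    [G t = \int_0^t gamma] and the integrating factor [expR (G / 2)], the linear
    equation yields [X t = expR (- G t / 2) X 0 + Y], where [Y] is the limit in
    probability of sums of weighted increments of [W].  These sums are Gaussian
    and independent of [F 0]; rescaling each of them to have variance exactly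
    [1 - expR (- G t)] makes the limit [Y] Gaussian of that variance and
    independent of [X 0], by a portmanteau argument.  Hence [(X 0, X t)] has the
    continuous density [p x * gaussian (sqrt alpha x) (1 - alpha) y], and Bayes'
    formula at [y = sqrt alpha xa] gives the claim, the scaling of the Gaussian
    by [sqrt alpha] turning the variance [1 - alpha] into [sigma2]. *)

Require Import Defs.
From HB Require Import structures.
From mathcomp Require Import all_boot all_order all_algebra.
From mathcomp Require Import all_classical all_reals all_analysis.
From mathcomp Require Import measurable_realfun ring lra.
Import Order.TTheory GRing.Theory Num.Theory.
Import numFieldNormedType.Exports.
Local Open Scope classical_set_scope.
Local Open Scope ring_scope.
Set Implicit Arguments.
Unset Strict Implicit.
Unset Printing Implicit Defensive.

(** * Borel sets and Lebesgue measure on row vectors *)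

(** The equation is available only as almost sure identities between pairs of times, each Ito
    integral being known as a limit in probability of Riemann sums. There is no Ito formula at hand,
    so the integrating factor is applied discretely: on a grid of [[0, t]] the equations of the
    single intervals are multiplied by weights and summed along each path, which exhibits the noise
    as a limit of weighted sums of Ito integrals. These integrals need not be measurable for the
    filtration; independence is read off from their Riemann sums and only then passed to the limit.
    The variance of such a sum depends on the grid. Once it is made exact, all approximants share
    one law, and the limit argument compares events instead of a varying family of laws. The other
    obstacle is [density], a choice among continuous densities: its values are known only after a
    continuous version has been exhibited and proved unique. For the law at time [t], continuity
    comes from dominated convergence. To make such theorems apply, the iterated [integral_rV] is
    first represented by a sigma-finite measure. *)

Notation borel R n := (g_sigma_algebraType (@open 'rV[R]_n)).

Section BorelSpace.
Context {R : realType}.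

Lemma open_borel (n : nat) (U : set 'rV[R]_n) :
  open U -> measurable (U : set (borel R n)).
Proof. exact: sub_sigma_algebra. Qed.

Lemma continuous_borel_measurable (n : nat) (f : 'rV[R]_n -> R) :
  continuous f -> measurable_fun setT (f : borel R n -> R).
Proof.
move=> cf; apply: (measurability _ (RGenOpens.measurableE R)).
move=> _ [_ [a [b ->]] <-]; rewrite setTI.
by apply: open_borel; apply: open_comp => [x _|]; [exact: cf|exact: interval_open].
Qed.

(** Sup-norm balls with rational centre and radius form a countable base. Each is a finite
    intersection of coordinate conditions, which is what reduces Borel measurability of a
    vector-valued map to its coordinates. *)
Lemma open_rV_ratr (n : nat) (U : set 'rV[R]_n) : open U ->
  U = \bigcup_(c in [set c : 'rV[rat]_n * rat |
        ball (map_mx ratr c.1 : 'rV[R]_n) (ratr c.2) `<=` U])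
      ball (map_mx ratr c.1 : 'rV[R]_n) (ratr c.2).
Proof.
move=> oU; apply/seteqP; split => [x Ux|x [c]]; last by apply.
have /nbhs_ballP[e e0 He] : nbhs x U by exact: open_nbhs_nbhs.
have e40 : (0 : R) < e / 2 by rewrite divr_gt0.
have [r] := @rat_in_itvoo R _ _ e40.
rewrite in_itv/= => /andP[r0 re].
have qP i : exists q : rat, ratr q \in `](x 0 i - ratr r)%R, (x 0 i)%R[.
  by apply: rat_in_itvoo; rewrite ltrBlDr ltrDl.
pose c : 'rV[rat]_n := \row_i projT1 (cid (qP i)).
have cx : ball (map_mx ratr c : 'rV[R]_n) (ratr r) x.
  split => // i j; rewrite !mxE ord1 /ball/=.
  case: cid => q /=; rewrite in_itv/= => /andP[].
  rewrite ltrBlDr => h1 h2; rewrite ltr_norml; apply/andP; split; lra.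
exists (c, r) => //= y cy; apply: He.
have -> : (e = e / 2 + e / 2) by rewrite -splitr.
apply: (@ball_triangle _ _ (map_mx ratr c : 'rV[R]_n)).
  by apply/ball_sym; apply: le_ball cx; exact/ltW.
by apply: le_ball cy; exact/ltW.
Qed.

Lemma measurable_rV {d} {T : measurableType d} (n : nat) (f : T -> borel R n) :
  (forall i, measurable_fun setT (fun x => (f x : 'rV[R]_n) 0 i)) ->
  measurable_fun setT f.
Proof.
move=> mf; apply: (@measurability _ _ T (borel R n) setT f (@open 'rV[R]_n) erefl).
move=> _ [U oU <-]; rewrite setTI (open_rV_ratr oU) preimage_bigcup.
rewrite bigcup_mkcond; apply: countable_bigcupT_measurable => // c.
case: ifPn => _ //.
(* A ball of nonpositive radius is empty. The coordinatewise description used for positive radii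
   would fail here when [n = 0], the empty intersection being everything. *)
have [r0|r0] := leP (ratr c.2 : R) 0.
  rewrite (_ : _ @^-1` _ = set0)//; apply/seteqP; split=> // x [/=].
  by rewrite ltNge r0.
rewrite (_ : _ @^-1` _ = \bigcap_(i in [set: 'I_n])
    ((fun x => (f x : 'rV[R]_n) 0 i) @^-1` ball (ratr (c.1 0 i) : R) (ratr c.2))).
  apply: fin_bigcap_measurable => // i _.
  rewrite -[X in measurable X]setTI; apply: mf => //.
  by apply: open_measurable; exact: ball_open.
apply/seteqP; split=> x /=.
  by move=> [_ H] i _; have := H ord0 i; rewrite mxE.
by move=> H; split=> // i j; rewrite mxE ord1; exact: H.
Qed.

Lemma measurable_coord (n : nat) (i : 'I_n) :
  measurable_fun setT (fun x : borel R n => (x : 'rV[R]_n) 0 i).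
Proof. by apply: continuous_borel_measurable => x; exact: coord_continuous. Qed.

Section Ops.
Context {d} {T : measurableType d}.

Lemma measurable_rVP (n : nat) (f : T -> borel R n) :
  measurable_fun setT f <->
  forall i, measurable_fun setT (fun x => (f x : 'rV[R]_n) 0 i).
Proof.
split=> [mf i|]; last exact: measurable_rV.
exact: (measurableT_comp (measurable_coord i)).
Qed.

Lemma measurable_row_mx (m n : nat) (f : T -> borel R m) (g : T -> borel R n) :
  measurable_fun setT f -> measurable_fun setT g ->
  measurable_fun setT (fun x => row_mx (f x) (g x) : borel R (m + n)).
Proof.
move=> /measurable_rVP mf /measurable_rVP mg; apply/measurable_rV => i.
have [j ->|j ->] := split_ordP i.
  by under eq_fun do rewrite row_mxEl; exact: mf.
by under eq_fun do rewrite row_mxEr; exact: mg.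
Qed.

Lemma measurable_const_rV (f : T -> R) : measurable_fun setT f ->
  measurable_fun setT (fun x => const_mx (f x) : borel R 1).
Proof. by move=> mf; apply/measurable_rV => i; under eq_fun do rewrite mxE. Qed.

Lemma measurable_rVD (n : nat) (f g : T -> borel R n) :
  measurable_fun setT f -> measurable_fun setT g ->
  measurable_fun setT (fun x => (f x : 'rV[R]_n) + g x : borel R n).
Proof.
move=> /measurable_rVP mf /measurable_rVP mg; apply/measurable_rV => i.
by under eq_fun do rewrite mxE; exact: measurable_funD.
Qed.

Lemma measurable_rVZ (n : nat) (c : R) (f : T -> borel R n) :
  measurable_fun setT f ->
  measurable_fun setT (fun x => c *: (f x : 'rV[R]_n) : borel R n).
Proof.
move=> /measurable_rVP mf; apply/measurable_rV => i.
by under eq_fun do rewrite mxE; exact: measurable_funM.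
Qed.

Lemma measurable_rV_sum (n : nat) I (r : seq I) (f : I -> T -> borel R n) :
  (forall i, measurable_fun setT (f i)) ->
  measurable_fun setT (fun x => \sum_(i <- r) (f i x : 'rV[R]_n) : borel R n).
Proof.
move=> mf; apply/measurable_rV => i; under eq_fun do rewrite summxE.
by apply: measurable_sum => j; exact: (measurable_rVP (f j)).1.
Qed.

End Ops.

Lemma continuous_norm2 (n : nat) : continuous (@norm2 R n).
Proof.
move=> x; apply: (@continuous_comp _ _ _ (fun y : 'rV[R]_n => \sum_(i < n) y 0 i ^+ 2)).
  apply: (cvg_big (@add_continuous R^o)) => [|i _]; first exact: (nbhs_filter x).
  apply: (@continuous_comp _ _ _ (fun y : 'rV[R]_n => y 0 i) (fun a => a ^+ 2)).
    exact: coord_continuous.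
  exact: exprn_continuous.
exact: sqrt_continuous.
Qed.

Section LebesgueRV.
Local Open Scope ereal_scope.

Definition consrV (m : nat) (z : measurableTypeR R * borel R m) : borel R m.+1 :=
  row_mx (const_mx z.1 : 'rV[R]_1) z.2.

Lemma measurable_consrV m : measurable_fun setT (@consrV m).
Proof.
apply: (@measurable_row_mx _ _ 1 m); last exact: measurable_snd.
by apply: measurable_const_rV; exact: measurable_fst.
Qed.

Definition sigma_finite_pack {d} {T : measurableType d}
    (M : {measure set T -> \bar R}) (sfM : sigma_finite setT M) :
  {sigma_finite_measure set T -> \bar R} :=
  HB.pack_for (SigmaFiniteMeasure.type T R) (Measure.sort M)
    (@isSFinite.Build _ _ _ M (sfinite_measure_sigma_finite sfM))
    (@isSigmaFinite.Build _ _ _ M sfM).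

(** By induction, the measure in dimension [n.+1] is the image under [consrV] of the product of
    Lebesgue measure with the measure in dimension [n]; Tonelli's theorem turns its integral into
    the iterated one. Sigma-finiteness belongs to the statement because Tonelli's theorem asks for
    it at the next dimension. *)
Lemma lebesgue_rV_exists (n : nat) :
  exists mu : {sigma_finite_measure set (borel R n) -> \bar R},
  forall f : borel R n -> \bar R, measurable_fun setT f ->
    (forall x, 0 <= f x) -> integral_rV f = \int[mu]_x f x.
Proof.
elim: n => [|n [mu IH]].
  exists (\d_(0%R : borel R 0)) => f mf f0 /=.
  by rewrite integral_dirac// diracT mul1e.
pose m : {measure set (measurableTypeR R * borel R n)%type -> \bar R} :=
  (@lebesgue_measure R \x mu).
pose M := measure_function_pushforward__canonical__measure_function_Measure
  m (@measurable_consrV n).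
have sfM : sigma_finite setT M.
  have /sigma_finiteP[F1 [F1T ndF1 mF1]] := sigma_finiteT (@lebesgue_measure R).
  have /sigma_finiteP[F2 [F2T ndF2 mF2]] := sigma_finiteT mu.
  pose F k := F1 k `*` F2 k.
  have FT : \bigcup_k F k = setT.
    rewrite -subTset => -[x y] _.
    have [i _ Fx] : (\bigcup_k F1 k) x by rewrite -F1T.
    have [j _ Fy] : (\bigcup_k F2 k) y by rewrite -F2T.
    exists (maxn i j) => //; split.
      by move: x Fx; exact/subsetPset/ndF1/leq_maxl.
    by move: y Fy; exact/subsetPset/ndF2/leq_maxr.
  have mF k : measurable (F k) /\ m (F k) < +oo.
    have [? ?] := mF1 k; have [? ?] := mF2 k.
    split; first exact: measurableX.
    by rewrite /m /= product_measure1E// lte_mul_pinfty// ge0_fin_numE.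
  (* A measurable left inverse of [consrV]: it carries the exhausting rectangles [F k] to Borel sets
     whose preimage under [consrV] is again [F k]. *)
  pose g (v : borel R n.+1) : measurableTypeR R * borel R n :=
    ((v : 'rV[R]_(1 + n)) ord0 (lshift n (@ord0 0)),
     \row_i (v : 'rV[R]_(1 + n)) ord0 (rshift 1 i)).
  have gK : cancel (@consrV n) g.
    move=> [a v]; rewrite /g /consrV/= row_mxEl mxE; congr pair.
    by apply/rowP => i; rewrite mxE row_mxEr.
  have mg : measurable_fun setT g.
    apply/measurable_fun_pairP; split; first exact: (@measurable_coord (1 + n)).
    apply/measurable_rV => i; under eq_fun do rewrite mxE.
    exact: (@measurable_coord (1 + n)).
  exists (fun k => g @^-1` F k).
    by rewrite -preimage_bigcup FT preimage_setT.
  move=> k; have [mFk Fk] := mF k; split.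
    by rewrite -[X in measurable X]setTI; exact: mg.
  by rewrite /M/= /pushforward -comp_preimage (_ : g \o _ = idfun)//; apply/funext.
pose N := sigma_finite_pack sfM.
exists N => f mf f0 /=.
transitivity (\int[m]_z f (consrV z)); last first.
  have E := ge0_integral_pushforward (@measurable_consrV n) m
    measurableT mf (fun y _ => f0 y).
  rewrite preimage_setT in E.
  transitivity (\int[pushforward m (@consrV n)]_x f x); first by rewrite E.
  reflexivity.
rewrite fubini_tonelli1//; last first.
  by apply: measurableT_comp => //; exact: measurable_consrV.
apply: eq_integral => a _; rewrite IH//.
apply: (measurableT_comp mf).
by apply: (@measurable_row_mx _ _ 1 n); [exact: measurable_cst|exact: measurable_id].
Qed.

Definition lebesgue_rV (n : nat) := sval (cid (lebesgue_rV_exists n)).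

Lemma integral_rVE (n : nat) (f : borel R n -> \bar R) :
  measurable_fun setT f -> (forall x, 0 <= f x) ->
  integral_rV f = \int[lebesgue_rV n]_x f x.
Proof. exact: (svalP (cid (lebesgue_rV_exists n))). Qed.

End LebesgueRV.
End BorelSpace.

(** * Iterated integrals *)

Section IntegralRV.
Context {R : realType}.
Local Open Scope ereal_scope.

(** The image of Lebesgue measure under [x |-> c * x + b], multiplied by [c], gives half-open
    intervals their length, hence is Lebesgue measure. The substitution then holds for every
    nonnegative measurable function. *)
Lemma ge0_integral_affine (c b : R) (f : measurableTypeR R -> \bar R) : (0 < c)%R ->
  measurable_fun setT f -> (forall x, 0 <= f x) ->
  \int[@lebesgue_measure R]_x f x =
  c%:E * \int[@lebesgue_measure R]_x f (c * x + b)%R.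
Proof.
move=> c0 mf f0.
pose phi : measurableTypeR R -> measurableTypeR R := fun x => (c * x + b)%R.
have mphi : measurable_fun setT phi.
  by apply: measurable_funD => //; exact: measurable_funM.
pose M := measure_function_pushforward__canonical__measure_function_Measure
  (@lebesgue_measure R) mphi.
pose N := mscale (NngNum (ltW c0)) M.
have NE (A : set (measurableTypeR R)) : measurable A -> lebesgue_measure A = N A.
  apply: lebesgue_measure_unique => _ [[x y] _ <-].
  change (lebesgue_measure `]x, y]%classic =
    c%:E * lebesgue_measure (phi @^-1` `]x, y]%classic)).
  rewrite (_ : phi @^-1` _ = `]((x - b) / c)%R, ((y - b) / c)%R]%classic); last first.
    apply/seteqP; split=> z; rewrite /phi/= !in_itv/= ltr_pdivrMr// ler_pdivlMr//;
      by rewrite ltrBlDr lerBrDr (mulrC z).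
  rewrite !lebesgue_measure_itv/= !lte_fin ltr_pM2r ?invr_gt0// ltrD2r.
  case: ifPn => _; last by rewrite mule0.
  rewrite -!EFinD -EFinM; congr EFin; field.
  by rewrite gt_eqF.
transitivity (\int[N]_x f x); first by apply: eq_measure_integral => A mA _; exact: NE.
rewrite ge0_integral_mscale//; congr (_ * _).
have := ge0_integral_pushforward mphi (@lebesgue_measure R) measurableT mf (fun y _ => f0 y).
by rewrite preimage_setT => <-.
Qed.

(** Associativity of concatenation, stated without a cast because [(1 + m) + n] and [(m + n).+1] are
    convertible. *)
Lemma row_mx_const_cons (m n : nat) (a : R) (x : 'rV[R]_m) (y : 'rV[R]_n) :
  row_mx (row_mx (const_mx a : 'rV_1) x) y =
  row_mx (const_mx a : 'rV_1) (row_mx x y) :> 'rV_(m + n).+1.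
Proof.
apply/rowP => i; have [j ->|j ->] := @split_ordP 1 (m + n) i.
  rewrite [RHS]row_mxEl (_ : lshift _ j = lshift n (lshift m j)); last exact/val_inj.
  by rewrite [LHS]row_mxEl row_mxEl.
rewrite [RHS]row_mxEr; have [k ->|k ->] := split_ordP j.
  rewrite (_ : rshift 1 _ = lshift n (rshift 1 k)); last exact/val_inj.
  by rewrite [LHS]row_mxEl [LHS]row_mxEr row_mxEl.
rewrite (_ : rshift 1 _ = rshift (1 + m) k); last exact/val_inj.
by rewrite [LHS]row_mxEr row_mxEr.
Qed.

Lemma integral_rV_row_mx (m n : nat) (f : 'rV[R]_(m + n) -> \bar R) :
  integral_rV f = integral_rV (fun x : 'rV_m => integral_rV (fun y => f (row_mx x y))).
Proof.
elim: m f => [|m IH] f /=.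
  congr integral_rV; apply/funext => y; congr f; apply/rowP => i.
  rewrite (_ : i = rshift 0 i :> 'I_(0 + n)); last exact/val_inj.
  by rewrite row_mxEr; congr (y _ _); exact/val_inj.
apply: eq_integral => a _; rewrite IH; congr integral_rV; apply/funext => x.
by congr integral_rV; apply/funext => y; rewrite row_mx_const_cons.
Qed.

Lemma measurable_integral_rV {d} {T : measurableType d} (n : nat)
    (f : T * borel R n -> \bar R) :
  measurable_fun setT f -> (forall z, 0 <= f z) ->
  measurable_fun setT (fun x => integral_rV (fun y => f (x, y))).
Proof.
move=> mf f0.
rewrite [X in measurable_fun _ X](_ : _ =
    fun x => \int[lebesgue_rV n]_y f (x, y)).
  exact: measurable_fun_fubini_tonelli_F.
apply/funext => x; rewrite integral_rVE => [//||y]; last exact: f0.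
exact: measurable_fun_pair2.
Qed.

Lemma integral_rV_ge0 (n : nat) (f : 'rV[R]_n -> \bar R) :
  (forall x, 0 <= f x) -> 0 <= integral_rV f.
Proof. by elim: n f => //= n IH f f0; apply: integral_ge0 => a _; apply: IH. Qed.

Lemma ge0_integral_rVZl (n : nat) (c : \bar R) (f : borel R n -> \bar R) :
  measurable_fun setT f -> (forall x, 0 <= f x) -> 0 <= c ->
  integral_rV (fun x => c * f x) = c * integral_rV f.
Proof.
move=> mf f0 c0; rewrite !integral_rVE//.
- by rewrite ge0_integralZl.
- exact: measurable_funeM.
- by move=> x; exact: mule_ge0.
Qed.

Lemma ge0_integral_rV_affine (n : nat) (c : R) (b : 'rV[R]_n)
    (f : borel R n -> \bar R) : (0 < c)%R ->
  measurable_fun setT f -> (forall x, 0 <= f x) ->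
  integral_rV f = (c ^+ n)%:E * integral_rV (fun x => f (c *: x + b)%R).
Proof.
move=> c0; elim: n b f => [|n IH] b f mf f0 /=.
  by rewrite expr0 mul1e; congr f; apply/rowP => -[].
pose b0 := (b : 'rV_(1 + n)) ord0 (lshift n ord0).
pose b1 : 'rV_n := \row_i (b : 'rV_(1 + n)) ord0 (rshift 1 i).
have bE a v : (c *: row_mx (const_mx a : 'rV_1) v + b)%R =
    row_mx (const_mx (c * a + b0)%R : 'rV_1) (c *: v + b1)%R :> 'rV_(1 + n).
  apply/rowP => i; rewrite !mxE /=; case: split_ordP => j -> ; rewrite !mxE //.
  by rewrite /b0 !ord1.
under [in RHS]eq_integral => a _ do under eq_fun do rewrite bE.
have mfr a : measurable_fun setT (fun v : borel R n => f (row_mx (const_mx a : 'rV_1) v)).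
  apply: (measurableT_comp mf).
  by apply: (@measurable_row_mx _ _ _ 1 n); [exact: measurable_cst|exact: measurable_id].
have mI : measurable_fun setT (fun a : measurableTypeR R =>
    integral_rV (fun v : 'rV_n => f (row_mx (const_mx a : 'rV_1) (c *: v + b1)%R))).
  pose F (z : measurableTypeR R * borel R n) :=
    f (row_mx (const_mx z.1 : 'rV_1) (c *: (z.2 : 'rV_n) + b1)%R).
  apply: (@measurable_integral_rV _ _ _ F) => [|z]; last exact: f0.
  apply: (measurableT_comp mf).
  apply: (@measurable_row_mx _ _ _ 1 n).
    by apply: measurable_const_rV; exact: measurable_fst.
  by apply: measurable_rVD; [apply: measurable_rVZ; exact: measurable_snd|exact: measurable_cst].
rewrite exprSr EFinM -muleA.
pose h a := integral_rV (fun v : 'rV_n => f (row_mx (const_mx a : 'rV_1) (c *: v + b1)%R)).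
rewrite -(@ge0_integral_affine c b0 h)//; last first.
  by move=> a; exact: integral_rV_ge0.
rewrite -ge0_integralZl//.
- by apply: eq_integral => a _; rewrite (IH b1).
- by move=> a _; exact: integral_rV_ge0.
- by rewrite lee_fin exprn_ge0// ltW.
Qed.

Lemma integral_rV_prod (n : nat) (f : 'I_n -> measurableTypeR R -> R) :
  (forall i, measurable_fun setT (f i)) -> (forall i x, (0 <= f i x)%R) ->
  integral_rV (fun x : 'rV[R]_n => (\prod_(i < n) f i (x ord0 i))%:E) =
  \prod_(i < n) \int[@lebesgue_measure R]_a (f i a)%:E.
Proof.
elim: n f => [|n IH] f mf f0 /=; first by rewrite !big_ord0.
rewrite big_ord_recl -IH//.
rewrite muleC -ge0_integralZl//; last 3 first.
- exact/measurable_EFinP.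
- by move=> a _; rewrite lee_fin.
- by apply: integral_rV_ge0 => x; rewrite lee_fin prodr_ge0.
apply: eq_integral => a _.
rewrite muleC -ge0_integral_rVZl//; last 3 first.
- apply/measurable_EFinP; apply: measurable_prod => i _.
  by apply: (measurableT_comp (mf _)); exact: measurable_coord.
- by move=> x; rewrite lee_fin prodr_ge0.
- by rewrite lee_fin.
congr integral_rV; apply/funext => v; rewrite -EFinM big_ord_recl; congr (_ * _)%:E.
  congr (f _ _); transitivity (row_mx (const_mx a : 'rV_1) v ord0 (lshift n ord0)).
    by congr (row_mx _ _ _ _); exact/val_inj.
  by rewrite row_mxEl mxE.
apply: eq_bigr => i _; congr (f _ _).
transitivity (row_mx (const_mx a : 'rV_1) v ord0 (rshift 1 i)).
  by congr (row_mx _ _ _ _); exact/val_inj.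
by rewrite row_mxEr.
Qed.

End IntegralRV.

(** * Measures given by a density, and laws on a product space *)

Section DensityMeasure.
Context {d} {T : measurableType d} {R : realType}.
Variables (mu : {measure set T -> \bar R}) (f : T -> R).
Hypotheses (mf : measurable_fun setT f) (f0 : forall x, 0 <= f x).
Local Open Scope ereal_scope.

(* The two proofs are arguments so that the measure structure is found by unification. *)
Definition density_measure (_ : measurable_fun setT f) (_ : forall x, (0 <= f x)%R)
  (A : set T) := \int[mu]_(x in A) (f x)%:E.

Local Notation nu := (density_measure mf f0).

Let nu0 : nu set0 = 0. Proof. exact: integral_set0. Qed.

Let nu_ge0 A : 0 <= nu A.
Proof. by apply: integral_ge0 => x _; rewrite lee_fin. Qed.

Let nu_sigma_additive : semi_sigma_additive nu.
Proof.
move=> F mF tF mUF; rewrite /density_measure ge0_integral_bigcup//.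
- by apply: is_cvg_ereal_nneg_natsum_cond => n _ _; exact: nu_ge0.
- by apply/measurable_EFinP; exact: measurable_funTS.
- by move=> x _; rewrite lee_fin.
Qed.

HB.instance Definition _ := isMeasure.Build _ _ _ nu nu0 nu_ge0 nu_sigma_additive.

Lemma density_measureE A : measurable A ->
  nu A = \int[mu]_x (f x * \1_A x)%:E.
Proof.
move=> mA; rewrite /density_measure integral_mkcond; apply: eq_integral => x _.
by rewrite patchE indicE; case: ifPn => _; rewrite ?mulr1 ?mulr0.
Qed.

End DensityMeasure.

Section JointLaw.
Context {R : realType} (m n : nat).
Local Open Scope ereal_scope.

(** Rectangles form a pi-system generating the product sigma-algebra, and by Tonelli's theorem the
    right-hand side is a measure in [C]. Every joint law below is identified on rectangles and then
    extended by this lemma. *)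
Lemma joint_measure_unique (mu : {measure set (borel R m * borel R n) -> \bar R})
    (f : borel R m * borel R n -> R) :
  measurable_fun setT f -> (forall z, (0 <= f z)%R) -> mu setT < +oo ->
  (forall A B, measurable A -> measurable B -> mu (A `*` B) =
    integral_rV (fun x => integral_rV (fun y => (f (x, y) * (\1_A x * \1_B y))%:E))) ->
  forall C, measurable C -> mu C =
    integral_rV (fun x => integral_rV (fun y => (f (x, y) * \1_C (x, y))%:E)).
Proof.
move=> mf f0 muoo muE C mC.
pose nu := density_measure (lebesgue_rV m \x lebesgue_rV n) mf f0.
have nuE D : measurable D -> nu D =
    integral_rV (fun x => integral_rV (fun y => (f (x, y) * \1_D (x, y))%:E)).
  move=> mD; rewrite /nu density_measureE//.
  have mg : measurable_fun setT (fun z => (f z * \1_D z)%:E).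
    by apply/measurable_EFinP; apply: measurable_funM => //; exact: measurable_indic.
  have g0 z : 0 <= (f z * \1_D z)%:E by rewrite lee_fin mulr_ge0.
  rewrite fubini_tonelli1// integral_rVE//.
  - apply: eq_integral => x _; rewrite integral_rVE//.
    exact: (measurable_fun_pair2 x mg).
  - exact: (measurable_integral_rV mg).
  - by move=> x; exact: integral_rV_ge0.
rewrite -nuE//.
pose G : set (set (borel R m * borel R n)) :=
  [set A | exists X, measurable X /\ exists Y, measurable Y /\ A = X `*` Y].
have -> : mu C = nu C.
  apply: (measure_unique G (fun=> setT)) => //.
  - rewrite measurable_prod_measurableType; congr (<<s _ >>).
    rewrite predeqE; split.
      by move=> [X mX [Y mY <-]]; exists X; split => //; exists Y.
    by move=> [X [mX [Y [mY ->]]]]; exists X => //; exists Y.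
  - move=> _ _ [X1 [mX1 [Y1 [mY1 ->]]]] [X2 [mX2 [Y2 [mY2 ->]]]].
    exists (X1 `&` X2); split; first exact: measurableI.
    by exists (Y1 `&` Y2); split; [exact: measurableI|rewrite setXI].
  - by move=> _; exists setT; split=> //; exists setT; split => //; rewrite setXTT.
  - by rewrite bigcup_const//; exists 0%N.
  - move=> _ [X [mX [Y [mY ->]]]]; rewrite [RHS]nuE; last exact: measurableX.
    by rewrite muE//; congr integral_rV; apply/funext => x; congr integral_rV;
      apply/funext => y; rewrite !indicE in_setX; case: (_ \in _); case: (_ \in _);
      rewrite ?mulr1 ?mulr0 ?mul0r.
by [].
Qed.

End JointLaw.

(** * Gaussian densities *)

Section Gaussian.
Context {R : realType}.

Lemma norm2_sqr (n : nat) (x : 'rV[R]_n) : norm2 x ^+ 2 = \sum_(i < n) x 0 i ^+ 2.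
Proof. by rewrite sqr_sqrtr// sumr_ge0// => i _; exact: sqr_ge0. Qed.

Definition gaussian1 (m v x : R) : R :=
  (Num.sqrt (2 * pi * v))^-1 * expR (- (x - m) ^+ 2 / (2 * v)).

(** Reduces the algebraic identities between isotropic Gaussian densities to dimension one. *)
Lemma gaussian_prod (n : nat) (m : 'rV[R]_n) (v : R) (x : 'rV[R]_n) : 0 <= v ->
  gaussian m v x = \prod_(i < n) gaussian1 (m 0 i) v (x 0 i).
Proof.
move=> v0; rewrite big_split/= prodr_const card_ord -expR_sum; congr (_ * expR _).
  have a0 : 0 <= 2 * pi * v by rewrite !mulr_ge0// pi_ge0.
  rewrite -{1}(sqr_sqrtr a0) -exprM mulnC exprM sqrtr_sqr exprVn.
  by rewrite ger0_norm// exprn_ge0// sqrtr_ge0.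
rewrite norm2_sqr -sumrN big_distrl/=; apply: eq_bigr => i _.
by rewrite !mxE.
Qed.

Lemma gaussian1_normal_pdf (m v : R) : 0 < v ->
  gaussian1 m v = normal_pdf m (Num.sqrt v).
Proof.
move=> v0; have s0 : Num.sqrt v != 0 by rewrite gt_eqF// sqrtr_gt0.
apply/funext => x; rewrite normal_pdfE// /normal_peak /normal_fun.
rewrite sqr_sqrtr ?ltW// /gaussian1; congr ((Num.sqrt _)^-1 * expR (_ / _)).
  by rewrite -mulr_natl; ring.
by rewrite -mulr_natl; ring.
Qed.

Lemma gaussian_gt0 (n : nat) (m : 'rV[R]_n) (v : R) (x : 'rV[R]_n) : 0 < v ->
  0 < gaussian m v x.
Proof.
move=> v0; rewrite mulr_gt0 ?expR_gt0// invr_gt0 sqrtr_gt0 exprn_gt0//.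
by rewrite !mulr_gt0// pi_gt0.
Qed.

Lemma gaussian_ge0 (n : nat) (m : 'rV[R]_n) (v : R) (x : 'rV[R]_n) :
  0 <= gaussian m v x.
Proof. by rewrite mulr_ge0 ?expR_ge0// invr_ge0 sqrtr_ge0. Qed.

Lemma gaussian_le (n : nat) (m : 'rV[R]_n) (v : R) (x : 'rV[R]_n) : 0 < v ->
  gaussian m v x <= (Num.sqrt ((2 * pi * v) ^+ n))^-1.
Proof.
move=> v0; rewrite ler_piMr ?invr_ge0 ?sqrtr_ge0// -[leRHS]expR0 ler_expR.
by rewrite mulNr oppr_le0 divr_ge0 ?sqr_ge0// mulr_ge0// ltW.
Qed.

Lemma gaussian_center (n : nat) (m : 'rV[R]_n) (v : R) (x : 'rV[R]_n) :
  gaussian m v x = gaussian 0 v (x - m).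
Proof. by rewrite /gaussian subr0. Qed.

Lemma continuous_gaussian0 (n : nat) (v : R) :
  continuous (fun x : 'rV[R]_n => gaussian 0 v x).
Proof.
pose phi (r : R) := (Num.sqrt ((2 * pi * v) ^+ n))^-1 * expR (- r ^+ 2 / (2 * v)).
rewrite (_ : (fun _ => _) = phi \o @norm2 R n); last first.
  by apply/funext => x; rewrite /gaussian subr0.
move=> x; apply: continuous_comp; first exact: continuous_norm2.
apply: cvgM; first exact: cvg_cst.
apply: (cvg_comp _ expR); last exact: continuous_expR.
apply: cvgM; last exact: cvg_cst.
by apply: (@cvgN _ R^o); exact: exprn_continuous.
Qed.

Lemma measurable_gaussian (n : nat) (m : 'rV[R]_n) (v : R) :
  measurable_fun setT (fun x : borel R n => gaussian m v x).
Proof.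
under eq_fun do rewrite gaussian_center.
apply: (measurableT_comp (continuous_borel_measurable (@continuous_gaussian0 n v))).
by apply: measurable_rVD; [exact: measurable_id|exact: measurable_cst].
Qed.

Lemma integral_gaussian (n : nat) (m : 'rV[R]_n) (v : R) : 0 < v ->
  integral_rV (fun x => (gaussian m v x)%:E) = 1%E.
Proof.
move=> v0; have s0 : Num.sqrt v != 0 by rewrite gt_eqF// sqrtr_gt0.
under eq_fun do rewrite (gaussian_prod _ _ (ltW v0)).
rewrite (@integral_rV_prod _ _ (fun i => gaussian1 (m 0 i) v)).
- rewrite big1// => i _; rewrite gaussian1_normal_pdf//; exact: integral_normal_pdf.
- by move=> i; rewrite gaussian1_normal_pdf//; exact: measurable_normal_pdf.
- by move=> i x; rewrite gaussian1_normal_pdf//; exact: normal_pdf_ge0.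
Qed.

(* Completing the square in each coordinate. *)
Lemma gaussianM (n : nat) (v w : R) (x z : 'rV[R]_n) : 0 < v -> 0 < w ->
  gaussian 0 v x * gaussian 0 w (z - x) =
  gaussian 0 (v + w) z * gaussian ((v / (v + w)) *: z) (v * w / (v + w)) x.
Proof.
move=> v0 w0; have vw0 : 0 < v + w by exact: addr_gt0.
have u0 : 0 < v * w / (v + w) by rewrite !mulr_gt0// invr_gt0.
rewrite !gaussian_prod ?ltW// -!big_split/=; apply: eq_bigr => i _.
rewrite !mxE /gaussian1 !subr0 mulrACA -expRD [RHS]mulrACA -expRD.
congr (_ * expR _); last by field; rewrite !gt_eqF.
have p0 := @pi_gt0 R.
rewrite -!invfM; congr (_^-1); rewrite -!sqrtrM ?mulr_ge0 ?ltW//.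
by congr Num.sqrt; field; rewrite gt_eqF.
Qed.

Lemma gaussianZ (n : nat) (v c : R) (x : 'rV[R]_n) : 0 < v -> 0 < c ->
  gaussian 0 v x = c ^+ n * gaussian 0 (c ^+ 2 * v) (c *: x).
Proof.
move=> v0 c0; have p0 := @pi_gt0 R.
have cv0 : 0 < c ^+ 2 * v by rewrite mulr_gt0// exprn_gt0.
have -> : c ^+ n = \prod_(i < n) c by rewrite prodr_const card_ord.
rewrite !gaussian_prod ?ltW// -big_split/=.
apply: eq_bigr => i _; rewrite !mxE /gaussian1 !subr0 [RHS]mulrA; congr (_ * expR _).
  have -> : Num.sqrt (2 * pi * (c ^+ 2 * v)) = c * Num.sqrt (2 * pi * v).
    rewrite (_ : 2 * pi * (c ^+ 2 * v) = c ^+ 2 * (2 * pi * v)); last by ring.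
    by rewrite (sqrtrM _ (sqr_ge0 c)) sqrtr_sqr gtr0_norm.
  by rewrite invfM mulrA divff ?gt_eqF// mul1r.
by field; rewrite !gt_eqF.
Qed.

End Gaussian.

(** * Independent Gaussian increments *)

Section IteratedIntegral.
Context {R : realType}.
Local Open Scope ereal_scope.

Lemma integral_rV_swap (m n : nat) (f : borel R m * borel R n -> \bar R) :
  measurable_fun setT f -> (forall z, 0 <= f z) ->
  integral_rV (fun x => integral_rV (fun y => f (x, y))) =
  integral_rV (fun y => integral_rV (fun x => f (x, y))).
Proof.
move=> mf f0.
have mf' : measurable_fun setT (fun z : borel R n * borel R m => f (z.2, z.1)).
  apply: (measurableT_comp mf); apply/measurable_fun_pairP.
  by split; [exact: measurable_snd|exact: measurable_fst].
transitivity (\int[lebesgue_rV m]_x \int[lebesgue_rV n]_y f (x, y)).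
  rewrite integral_rVE.
  - apply: eq_integral => x _; rewrite integral_rVE//.
    exact: (measurable_fun_pair2 x mf).
  - exact: (measurable_integral_rV mf).
  - by move=> x; exact: integral_rV_ge0.
rewrite fubini_tonelli// [RHS]integral_rVE.
- apply: eq_integral => y _; rewrite integral_rVE//.
  exact: (measurable_fun_pair1 y mf).
- exact: (measurable_integral_rV mf').
- by move=> x; exact: integral_rV_ge0.
Qed.

Lemma eq_integral_rV (n : nat) (f g : 'rV[R]_n -> \bar R) :
  f =1 g -> integral_rV f = integral_rV g.
Proof. by move=> fg; congr integral_rV; apply/funext. Qed.

Lemma integral_rV_prod2 (m n : nat) (g : borel R m -> R) (h : borel R n -> R) :
  measurable_fun setT g -> measurable_fun setT h ->
  (forall x, (0 <= g x)%R) -> (forall y, (0 <= h y)%R) ->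
  integral_rV (fun x => integral_rV (fun y => (g x * h y)%:E)) =
  integral_rV (fun x => (g x)%:E) * integral_rV (fun y => (h y)%:E).
Proof.
move=> mg mh g0 h0.
under eq_fun => x.
  under eq_fun do rewrite EFinM.
  rewrite ge0_integral_rVZl//; last 2 first.
    exact/measurable_EFinP.
    by rewrite lee_fin.
  rewrite muleC.
  over.
rewrite ge0_integral_rVZl//; first by rewrite muleC.
  exact/measurable_EFinP.
by apply: integral_rV_ge0 => y; rewrite lee_fin.
Qed.

End IteratedIntegral.

Section SubSigmaAlgebra.
Context {R : realType} {T : pointedType}.

(** A member of a filtration is a bare set of sets. Viewing it as the sigma-algebra of a measurable
    space makes the closure of measurable maps under sums and multiples available for
    adaptedness. *)
Lemma sub_measurable_rVP (n : nat) (G : set (set T)) (S : T -> 'rV[R]_n) :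
  sigma_algebra setT G ->
  (forall A, borel_rV A -> G (S @^-1` A)) <->
  measurable_fun setT (S : g_sigma_algebraType G -> borel R n).
Proof.
move=> sG; split => [GS _ A mA|mS A mA].
  by rewrite setTI; apply: sub_sigma_algebra; exact: GS.
rewrite -(sigma_algebra_id sG) -[_ @^-1` _]setTI.
exact: mS.
Qed.

End SubSigmaAlgebra.

Section GaussianIncrements.
Context {R : realType} {d} {T : measurableType d} (P : probability T R) (n : nat).
Local Open Scope ereal_scope.

Definition gauss_law (v : R) (A : set 'rV[R]_n) : \bar R :=
  integral_rV (fun x => (gaussian 0 v x * \1_A x)%:E).

(** One equation encodes both the law ([E] the whole space) and the independence of [F1].
    Measurability for the later sigma-algebra [F2] is what allows a further increment, independent
    of [F2], to be added. *)
Definition indep_gaussian (F1 F2 : set (set T)) (v : R) (S : T -> 'rV[R]_n) :=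
  [/\ (0 < v)%R,
      forall A, borel_rV A -> F2 (S @^-1` A) &
      forall E A, F1 E -> borel_rV A -> P (E `&` S @^-1` A) = P E * gauss_law v A].

Lemma measurable_mul_indic (f : borel R n -> R) (A : set 'rV[R]_n) :
  measurable_fun setT f -> borel_rV A ->
  measurable_fun setT (fun x : borel R n => (f x * \1_A x)%R).
Proof. by move=> mf mA; apply: measurable_funM => //; exact: measurable_indic. Qed.

Lemma measurable_indic_comp {d'} {T' : measurableType d'} (A : set 'rV[R]_n)
    (g : T' -> borel R n) : borel_rV A -> measurable_fun setT g ->
  measurable_fun setT (fun z => \1_A (g z) : R).
Proof.
by move=> mA mg; apply: (@measurableT_comp _ _ _ _ _ _ (\1_A : borel R n -> R)) => //.
Qed.

(** Substitute [z = x + y] in the inner integral, exchange the integrals, and complete the square by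
    [gaussianM]: what remains in [x] is a Gaussian density of total mass 1. *)
Lemma gauss_law_convol (v w : R) (A : set 'rV[R]_n) : (0 < v)%R -> (0 < w)%R ->
  borel_rV A ->
  integral_rV (fun x => integral_rV (fun y =>
    (gaussian 0 v x * gaussian 0 w y * \1_A (x + y)%R)%:E)) = gauss_law (v + w) A.
Proof.
move=> v0 w0 mA.
have mg := measurable_gaussian.
pose f (z : borel R n * borel R n) :=
  (gaussian 0 v (z.1 : 'rV_n) * gaussian 0 w ((z.2 : 'rV_n) - z.1) * \1_A (z.2 : 'rV_n))%R.
have mf : measurable_fun setT (EFin \o f).
  apply/measurable_EFinP; apply: measurable_funM.
    apply: measurable_funM.
      exact: (measurableT_comp (mg _ _ _ _) measurable_fst).
    apply: (measurableT_comp (mg _ _ _ _)).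
    rewrite (_ : (fun z => _) = fun z : borel R n * borel R n =>
      ((z.2 : 'rV[R]_n) + (-1)%R *: (z.1 : 'rV[R]_n))%R); last first.
      by apply/funext => z; rewrite scaleN1r.
    by apply: measurable_rVD; [exact: measurable_snd|apply: measurable_rVZ; exact: measurable_fst].
  exact: (measurable_indic_comp mA measurable_snd).
have f0 z : 0 <= (EFin \o f) z by rewrite lee_fin !mulr_ge0// gaussian_ge0.
transitivity (integral_rV (fun x => integral_rV (fun z => (EFin \o f) (x, z)))).
  apply: eq_integral_rV => x.
  rewrite (@ge0_integral_rV_affine _ _ 1 (- x)%R)//.
  - rewrite expr1n mul1e; apply: eq_integral_rV => z.
    by rewrite /f/= scale1r (addrC x) subrK.
  - apply/measurable_EFinP; apply: measurable_funM.
      by apply: measurable_funM => //; exact: mg.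
    apply: (measurable_indic_comp mA).
    by apply: measurable_rVD; [exact: measurable_cst|exact: measurable_id].
  - by move=> z; rewrite lee_fin !mulr_ge0// gaussian_ge0.
rewrite integral_rV_swap//; apply: eq_integral_rV => z.
pose u := (v * w / (v + w))%R.
have u0 : (0 < u)%R by rewrite /u !mulr_gt0// invr_gt0 addr_gt0.
transitivity (integral_rV (fun x => (gaussian 0 (v + w) z * \1_A z)%:E *
    (gaussian ((v / (v + w)) *: z)%R u x)%:E)).
  by apply: eq_integral_rV => x; rewrite /f/= gaussianM// -EFinM; congr EFin; ring.
rewrite ge0_integral_rVZl ?integral_gaussian ?mule1//.
- by apply/measurable_EFinP; exact: mg.
- by move=> x; rewrite lee_fin gaussian_ge0.
- by rewrite lee_fin mulr_ge0// gaussian_ge0.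
Qed.

(* The joint law of [S] and [S'] on [E] is a product, and the sum is its image. *)
Lemma indep_gaussianD (F1 F2 F3 : set (set T)) (v w : R) (S S' : T -> 'rV[R]_n) :
  sigma_algebra setT F2 -> sigma_algebra setT F3 ->
  F1 `<=` F2 -> F2 `<=` F3 -> F3 `<=` measurable ->
  indep_gaussian F1 F2 v S -> indep_gaussian F2 F3 w S' ->
  indep_gaussian F1 F3 (v + w) (fun t => S t + S' t)%R.
Proof.
move=> s2 s3 F12 F23 F3m [v0 SF2 SP] [w0 SF3 SP'].
have mS : measurable_fun setT (S : T -> borel R n).
  by move=> _ A mA; rewrite setTI; apply: F3m; apply: F23; exact: SF2.
have mS' : measurable_fun setT (S' : T -> borel R n).
  by move=> _ A mA; rewrite setTI; apply: F3m; exact: SF3.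
have mSS : measurable_fun setT (fun t => (S t : borel R n, S' t : borel R n)).
  by apply/measurable_fun_pairP.
split; first exact: addr_gt0.
  apply/(sub_measurable_rVP _ s3); apply: measurable_rVD; apply/(sub_measurable_rVP _ s3) => //.
  by move=> A mA; apply: F23; exact: SF2.
move=> E A F1E mA.
have mE : measurable E by apply: F3m; apply: F23; exact: F12.
pose mu := measure_function_pushforward__canonical__measure_function_Measure
  (mrestr P mE) mSS.
have PE : P E \is a fin_num by exact: fin_num_measure.
pose e := fine (P E).
have e0 : (0 <= e)%R by exact: fine_ge0.
pose f (z : borel R n * borel R n) :=
  (e * gaussian 0 v (z.1 : 'rV_n) * gaussian 0 w (z.2 : 'rV_n))%R.
have mg := measurable_gaussian.
have mf : measurable_fun setT f.
  apply: measurable_funM; last exact: (measurableT_comp (mg _ _ _ _) measurable_snd).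
  by apply: measurable_funM => //; exact: (measurableT_comp (mg _ _ _ _) measurable_fst).
have f0 z : (0 <= f z)%R by rewrite !mulr_ge0// gaussian_ge0.
pose C : set (borel R n * borel R n) := (fun z => (z.1 : 'rV_n) + z.2 : borel R n)%R @^-1` A.
have mC : measurable C.
  rewrite -[C]setTI; apply: (@measurable_rVD _ _ _ n fst snd) => //.
transitivity (mu C); first by rewrite setIC.
rewrite (joint_measure_unique mf f0)//.
- transitivity (integral_rV (fun x : 'rV[R]_n => e%:E * integral_rV (fun y : 'rV[R]_n =>
    (gaussian 0 v x * gaussian 0 w y * \1_A (x + y)%R)%:E))).
    apply: eq_integral_rV => x; rewrite -ge0_integral_rVZl//.
    + by apply: eq_integral_rV => y; rewrite /f/= -EFinM; congr EFin; rewrite !mulrA.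
    + apply/measurable_EFinP; apply: measurable_funM.
        by apply: measurable_funM => //; exact: mg.
      apply: (measurable_indic_comp mA).
      by apply: measurable_rVD; [exact: measurable_cst|exact: measurable_id].
    + by move=> y; rewrite lee_fin !mulr_ge0// gaussian_ge0.
  rewrite ge0_integral_rVZl//.
  + by rewrite gauss_law_convol// /e fineK.
  + pose g (z : borel R n * borel R n) := (gaussian 0 v (z.1 : 'rV_n) *
      gaussian 0 w (z.2 : 'rV_n) * \1_A ((z.1 : 'rV_n) + z.2)%R)%:E.
    apply: (@measurable_integral_rV _ _ _ _ g) => [|z].
      apply/measurable_EFinP; apply: measurable_funM.
        apply: measurable_funM; last exact: (measurableT_comp (mg _ _ _ _) measurable_snd).
        exact: (measurableT_comp (mg _ _ _ _) measurable_fst).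
      apply: (measurable_indic_comp mA).
      by apply: measurable_rVD; [exact: measurable_fst|exact: measurable_snd].
    by rewrite lee_fin !mulr_ge0// gaussian_ge0.
  + move=> x; apply: integral_rV_ge0 => y.
    by rewrite lee_fin !mulr_ge0// gaussian_ge0.
- change (P ((fun t => (S t, S' t)) @^-1` setT `&` E) < +oo).
  by rewrite preimage_setT setTI (le_lt_trans (probability_le1 P mE))// ltry.
- move=> A1 A2 mA1 mA2.
  transitivity (P ((E `&` S @^-1` A1) `&` S' @^-1` A2)).
    transitivity (P ((S @^-1` A1 `&` S' @^-1` A2) `&` E)) => //.
    by rewrite setIC setIA.
  (* The event that [E] holds and [S] is in [A1] belongs to [F2], of which [S'] is independent. *)
  rewrite SP' ?SP//; last first.
    by have [] := (sigma_algebraP (fun _ _ => @subsetT _ _)).1 s2; move=> _ _ _; apply;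
      [exact: F12|exact: SF2].
  transitivity (e%:E * gauss_law v A1 * gauss_law w A2); first by rewrite /e fineK.
  rewrite {1}/gauss_law -(@ge0_integral_rVZl _ _ e%:E
    (fun x => (gaussian 0 v x * \1_A1 x)%:E)); first last.
  + by rewrite lee_fin.
  + by move=> y; rewrite lee_fin !mulr_ge0// gaussian_ge0.
  + by apply/measurable_EFinP; exact: (measurable_mul_indic (mg _ _ _ _) mA1).
  rewrite -(@integral_rV_prod2 _ _ _ (fun x => e * (gaussian 0 v x * \1_A1 x))%R
    (fun x => gaussian 0 w x * \1_A2 x)%R).
  + apply: eq_integral_rV => x; apply: eq_integral_rV => y; rewrite /f/=.
    by congr EFin; ring.
  + by apply: measurable_funM => //; exact: (measurable_mul_indic (mg _ _ _ _) mA1).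
  + exact: (measurable_mul_indic (mg _ _ _ _) mA2).
  + by move=> y; rewrite !mulr_ge0// gaussian_ge0.
  + by move=> y; rewrite !mulr_ge0// gaussian_ge0.
Qed.

End GaussianIncrements.

(** * Limits in probability of Gaussian variables *)

Section LimitLaw.
Context {R : realType} (n : nat).

(** The inner parallel set of [U]: a point of it moved by less than [r] stays in [U]. These sets are
    closed, and for open [U] they exhaust [U] as [r] decreases to 0. *)
Definition inner_set (U : set 'rV[R]_n) (r : R) : set 'rV[R]_n :=
  [set x | forall y, ball x r y -> U y].

Lemma closed_inner_set (U : set 'rV[R]_n) (r : R) : closed (inner_set U r).
Proof.
rewrite -[inner_set U r]setCK; apply: open_closedC; rewrite openE => x /= /existsNP[y].
move=> /not_implyP[xy nUy]; have [r0 H] := xy.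
have oB : open (ball y r) by exact: ball_open.
have := open_nbhs_nbhs (conj oB (ball_sym xy)).
apply: filterS => z yz /= zU; apply: nUy; apply: zU; exact: ball_sym.
Qed.

Lemma inner_set_measurable (U : set 'rV[R]_n) (r : R) : borel_rV (inner_set U r).
Proof.
rewrite -[inner_set U r]setCK.
apply: (@measurableC _ (borel R n)); apply: sub_sigma_algebra.
by apply: closed_openC; exact: closed_inner_set.
Qed.

Lemma inner_set_bigcup (U : set 'rV[R]_n) : open U ->
  \bigcup_k inner_set U k.+1%:R^-1 = U.
Proof.
move=> oU; apply/seteqP; split => [x [k _ /(_ x)]|x Ux].
  by apply; apply: ballxx; rewrite invr_gt0.
have /nbhs_ballP[e e0 He] : nbhs x U by exact: open_nbhs_nbhs.
have [k ke] : exists k : nat, k.+1%:R^-1 < e.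
  have [k _ Hk] := near_infty_natSinv_lt (PosNum e0).
  by exists k; apply: Hk => /=.
exists k => // y xy; apply: He; apply: le_ball xy; exact: ltW.
Qed.

Lemma nondecreasing_inner_set (U : set 'rV[R]_n) :
  nondecreasing_seq (fun k : nat => inner_set U k.+1%:R^-1).
Proof.
move=> i j ij; apply/subsetPset => x + y xy; apply.
by apply: le_ball xy; rewrite lef_pV2 ?posrE// ler_nat ltnS.
Qed.

Lemma ler_coord_norm2 (x : 'rV[R]_n) (i : 'I_n) : `|x 0 i| <= norm2 x.
Proof.
rewrite -sqrtr_sqr ler_sqrt ?sumr_ge0//; last by move=> *; exact: sqr_ge0.
by rewrite (bigD1 i)//= lerDl sumr_ge0// => *; exact: sqr_ge0.
Qed.

(** Convergence in probability is given in the Euclidean norm, while balls and topology are those of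
    the sup norm; this inequality is the passage between them. *)
Lemma ler_norm_norm2 (x : 'rV[R]_n) : `|x| <= norm2 x.
Proof.
rewrite leNgt; apply/negP => h.
have : ball x `|x| 0.
  split; first by apply: le_lt_trans h; exact: sqrtr_ge0.
  move=> i j; rewrite ord1 /ball/= mxE subr0; apply: le_lt_trans h.
  exact: ler_coord_norm2.
by rewrite -ball_normE /= subr0 ltxx.
Qed.

Section Measures.
Variables mu nu : {measure set (borel R n) -> \bar R}.
Hypotheses (munuT : mu setT = nu setT) (muoo : (mu setT < +oo)%E).
(** This is what closeness in probability provides: if [S] is in [inner_set U r] and within [r] of
    [Y], then [Y] is in [U], and the exceptional event has probability at most [r]. Radius and error
    share one sequence. *)
Hypothesis numu : forall U : set 'rV[R]_n, open U ->
  forall k : nat, (nu (inner_set U k.+1%:R^-1) <= mu U + k.+1%:R^-1%:E)%E.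

Lemma le_measure_open (U : set 'rV[R]_n) : open U -> (nu U <= mu U)%E.
Proof.
move=> oU; have mI k : measurable (inner_set U k.+1%:R^-1 : set (borel R n)).
  exact: inner_set_measurable.
have mU : measurable (\bigcup_k inner_set U k.+1%:R^-1 : set (borel R n)).
  exact: bigcupT_measurable.
have := nondecreasing_cvg_mu (mu := nu) mI mU (@nondecreasing_inner_set U).
rewrite inner_set_bigcup// => cU.
apply/lee_addgt0Pr => e e0; rewrite -(cvg_lim _ cU)//.
apply: lime_le; first by apply/cvg_ex; exists (nu U).
near=> k; apply: (le_trans (numu oU k)); rewrite leeD2l// lee_fin.
by apply: ltW; near: k; exact: (near_infty_natSinv_lt (PosNum e0)).
Unshelve. all: by end_near. Qed.

Lemma le_measure_closed (C : set 'rV[R]_n) : closed C -> (mu C <= nu C)%E.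
Proof.
move=> cC; have oC : open (~` C) by exact: closed_openC.
have mC' : measurable (~` C : set (borel R n)) by exact: sub_sigma_algebra.
have mC : measurable (C : set (borel R n)) by rewrite -[C]setCK; exact: measurableC.
have h := le_measure_open oC.
have e (m : {measure set (borel R n) -> \bar R}) : (m setT = m C + m (~` C))%E.
  by rewrite -measureU//; [rewrite setUv|rewrite setICr].
have nuoo : (nu setT < +oo)%E by rewrite -munuT.
have f (m : {measure set (borel R n) -> \bar R}) A : (m setT < +oo)%E ->
    measurable A -> m A \is a fin_num.
  move=> moo mA; rewrite ge0_fin_numE//; apply: le_lt_trans moo.
  by apply: le_measure => //; rewrite inE.
move: munuT h; rewrite !e.
rewrite -(fineK (f mu _ muoo mC)) -(fineK (f mu _ muoo mC')).
rewrite -(fineK (f nu _ nuoo mC)) -(fineK (f nu _ nuoo mC')).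
rewrite -!EFinD !lee_fin => -[h1] h2; lra.
Qed.

(** A one-sided estimate suffices. It gives [nu <= mu] on open sets, hence [mu <= nu] on closed sets
    since the total masses are equal and finite; exhausting an open set by its closed inner sets
    gives the reverse inequality. Open sets form a pi-system generating the Borel sets. *)
Lemma eq_measure_portmanteau (A : set (borel R n)) : measurable A -> mu A = nu A.
Proof.
move=> mA; apply: (@measure_unique _ R (borel R n) (@open 'rV[R]_n) (fun=> setT)) => //.
- exact: openI.
- by move=> _; exact: openT.
- by rewrite bigcup_const//; exists 0%N.
move=> U oU; apply/eqP; rewrite eq_le le_measure_open// andbT.
have mI k : measurable (inner_set U k.+1%:R^-1 : set (borel R n)).
  exact: inner_set_measurable.
have mU : measurable (\bigcup_k inner_set U k.+1%:R^-1 : set (borel R n)).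
  exact: bigcupT_measurable.
have := nondecreasing_cvg_mu (mu := mu) mI mU (@nondecreasing_inner_set U).
rewrite inner_set_bigcup// => cU; rewrite -(cvg_lim _ cU)//.
apply: lime_le; first by apply/cvg_ex; exists (mu U).
apply: nearW => k /=; apply: (le_trans (le_measure_closed (@closed_inner_set U _))).
apply: le_measure; rewrite ?inE//; first exact: sub_sigma_algebra.
by rewrite -[X in _ `<=` X](inner_set_bigcup oU) => x Ix; exists k.
Qed.

End Measures.

Section GaussianLimit.
Context {d} {T : measurableType d} (P : probability T R).
Local Open Scope ereal_scope.

Lemma gauss_lawT (v : R) : (0 < v)%R -> gauss_law v [set: 'rV[R]_n] = 1.
Proof.
move=> v0; rewrite -(@integral_gaussian _ n 0 v v0); apply: eq_integral_rV => x.
by rewrite indicT mulr1.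
Qed.

(** With [E] fixed, the two measures compared are the law of [Y] on [E] and [P E] times the Gaussian
    law. All the approximants [S] have exactly the second one as law on [E], so no convergence of
    Gaussian laws is involved. *)
Lemma indep_gaussian_lim (F1 F2 : set (set T)) (v : R) (Y : T -> 'rV[R]_n) :
  (0 < v)%R -> measurable_fun setT (Y : T -> borel R n) ->
  F1 `<=` measurable -> F2 `<=` measurable ->
  (forall r : R, (0 < r)%R -> exists2 S : T -> 'rV[R]_n,
    indep_gaussian P F1 F2 v S &
    P [set w | (r <= `|S w - Y w|)%R] <= r%:E) ->
  forall E A, F1 E -> borel_rV A -> P (E `&` Y @^-1` A) = P E * gauss_law v A.
Proof.
move=> v0 mY F1m F2m H E A F1E mA.
have mE : measurable E by exact: F1m.
pose mu := measure_function_pushforward__canonical__measure_function_Measure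
  (mrestr P mE) mY.
have PE : P E \is a fin_num by exact: fin_num_measure.
pose f (x : borel R n) := (fine (P E) * gaussian 0 v (x : 'rV[R]_n))%R.
have mf : measurable_fun setT f.
  by apply: measurable_funM => //; exact: measurable_gaussian.
have f0 x : (0 <= f x)%R by rewrite mulr_ge0// ?gaussian_ge0 ?fine_ge0.
pose nu := density_measure (lebesgue_rV n) mf f0.
have muE B : mu B = P (E `&` Y @^-1` B) by rewrite setIC.
have nuE B : borel_rV B -> nu B = P E * gauss_law v B.
  move=> mB; rewrite /nu/= density_measureE// -integral_rVE.
  - rewrite -[in RHS](fineK PE) -ge0_integral_rVZl//.
    + by apply: eq_integral_rV => x; rewrite -EFinM mulrA.
    + by apply/measurable_EFinP; exact: (measurable_mul_indic (measurable_gaussian _ _) mB).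
    + by move=> x; rewrite lee_fin mulr_ge0// gaussian_ge0.
    + by rewrite lee_fin fine_ge0.
  - by apply/measurable_EFinP; exact: (measurable_mul_indic mf mB).
  - by move=> x; rewrite lee_fin mulr_ge0.
rewrite -muE -nuE//; apply: eq_measure_portmanteau => //.
- rewrite muE preimage_setT setIT; apply/esym.
  rewrite -[RHS]mule1 -(gauss_lawT v0); apply: nuE; exact: (@measurableT _ (borel R n)).
- by rewrite muE preimage_setT setIT; rewrite -(fineK PE) ltry.
move=> U oU k; set r : R := (k.+1%:R^-1)%R.
have r0 : (0 < r)%R by rewrite invr_gt0.
have [S [_ SF2 SP] Sr] := H r r0.
have mI : borel_rV (inner_set U r) by exact: inner_set_measurable.
rewrite [X in X <= _]nuE// -SP// muE.
have mS : measurable_fun setT (S : T -> borel R n).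
  by move=> _ B mB; rewrite setTI; apply: F2m; exact: SF2.
have mD : measurable [set w | (r <= `|S w - Y w|)%R].
  rewrite -[X in measurable X]setTI.
  have mg : measurable_fun setT (fun w => `|S w - Y w|%R).
    apply: (measurableT_comp (continuous_borel_measurable (@norm_continuous R 'rV[R]_n))).
    rewrite (_ : (fun w => _) = (fun w => S w + (-1) *: Y w)%R); last first.
      by apply/funext => w; rewrite scaleN1r.
    by apply: measurable_rVD => //; exact: measurable_rVZ.
  exact: measurable_fun_le.
have mU : measurable (E `&` Y @^-1` U).
  apply: measurableI => //; rewrite -[_ @^-1` _]setTI.
  exact: (mY measurableT _ (open_borel oU)).
apply: (@le_trans _ _ (P (E `&` Y @^-1` U `|` [set w | (r <= `|S w - Y w|)%R]))).
  apply: le_measure; rewrite ?inE//.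
  - by apply: measurableI => //; exact/F2m/SF2.
  - exact: measurableU.
  move=> w [Ew SUw]; have [|lt_r] := leP r (`|S w - Y w|)%R; first by right.
  by left; split => //; apply: SUw; rewrite -ball_normE.
by apply: le_trans; [exact: measureU2|rewrite leeD2l].
Qed.

End GaussianLimit.
End LimitLaw.

(** * Riemann sums along real paths *)

Section RealPaths.
Context {R : realType}.
Local Notation mu := (@lebesgue_measure R).

(** Heine's theorem from the near-covering form of compactness: a property valid locally for all
    small [r > 0] is valid on the whole segment for all small [r > 0]. Half of the local radius is
    spent on moving the base point, half on [r]. *)
Lemma within_itv_unif_continuous (f : R -> R) (a b : R) :
  {within `[a, b], continuous f} -> forall e : R, 0 < e ->
  exists2 r : R, 0 < r & forall x y, x \in `[a, b] -> y \in `[a, b] ->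
    `|x - y| < r -> `|f x - f y| <= e.
Proof.
move=> cf e e0.
pose Q r x := forall y, y \in `[a, b] -> `|x - y| < r -> x \in `[a, b] -> `|f x - f y| <= e.
have K := (compact_near_coveringP _).1 (@segment_compact R a b).
have : \forall r \near (0 : R)^'+, `[a, b]%classic `<=` Q r.
  apply: K => x abx.
  move/subspace_continuousP : cf => /(_ x abx)/cvgrPdist_lt/(_ (e / 2)).
  rewrite divr_gt0// => /(_ isT); rewrite near_withinE => /nbhs_ballP[r/= r0 Hr].
  exists (ball x (r / 2), [set s | 0 < s < r / 2]).
    split => /=; first by apply: nbhsx_ballx; rewrite divr_gt0.
    have r20 : 0 < r / 2 by rewrite divr_gt0.
    by apply: filterS2 (nbhs_right_gt 0) (nbhs_right_lt r20) => s /= -> ->.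
  move=> [x' s] /= [xx' /andP[s0 sr]] y aby x'y abx'.
  have h z : z \in `[a, b] -> `|x - z| < r -> `|f x - f z| < e / 2.
    by move=> abz xz; exact: Hr.
  have r2 : r / 2 < r by rewrite ltr_pdivrMr// ltr_pMr// ltr1n.
  have h1 := h _ abx' (lt_trans xx' r2).
  have xy : `|x - y| < r.
    rewrite (_ : x - y = (x - x') + (x' - y)); last by ring.
    rewrite (le_lt_trans (ler_normD _ _))// [ltRHS]splitr ltrD//.
    exact: lt_trans sr.
  have h2 := h _ aby xy.
  rewrite (_ : f x' - f y = (f x - f y) - (f x - f x')); last by ring.
  by rewrite (le_trans (ler_normB _ _))// [leRHS]splitr lerD ?ltW.
rewrite /at_right near_withinE => /nbhs_ballP[r/= r0 Hr].
exists (r / 2); first by rewrite divr_gt0.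
move=> x y abx aby xy; have r20 : 0 < r / 2 by rewrite divr_gt0.
suff rr : ball 0 r (r / 2) by exact: (Hr _ rr r20 x abx y aby xy abx).
by rewrite /ball/= sub0r normrN gtr0_norm// ltr_pdivrMr// ltr_pMr// ltr1n.
Qed.

Lemma within_itv_norm (f : R -> R) (a b : R) :
  {within `[a, b], continuous f} -> {within `[a, b], continuous (fun x => `|f x|)}.
Proof.
by move=> cf x; apply: continuous_comp; [exact: cf|exact: norm_continuous].
Qed.

Lemma within_itvM (f g : R -> R) (a b : R) :
  {within `[a, b], continuous f} -> {within `[a, b], continuous g} ->
  {within `[a, b], continuous (fun x => f x * g x)}.
Proof. by move=> cf cg x; apply: continuousM; [exact: cf|exact: cg]. Qed.

Lemma within_itvZ (c : R) (f : R -> R) (a b : R) :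
  {within `[a, b], continuous f} -> {within `[a, b], continuous (fun x => c * f x)}.
Proof. by move=> cf; apply: within_itvM => // x; exact: cst_continuous. Qed.

Lemma within_itv_bounded (f : R -> R) (a b : R) : a <= b ->
  {within `[a, b], continuous f} ->
  exists2 M, 0 <= M & forall x, x \in `[a, b] -> `|f x| <= M.
Proof.
move=> ab cf.
have [c cab H] := EVT_max ab (within_itv_norm cf).
by exists `|f c|.
Qed.

Lemma within_itv_integrable (f : R -> R) (a b : R) :
  {within `[a, b], continuous f} -> mu.-integrable `[a, b] (EFin \o f).
Proof. by move=> cf; apply: continuous_compact_integrable => //; exact: segment_compact. Qed.

Lemma within_itvS (f : R -> R) (a b c d : R) : a <= c -> d <= b ->
  {within `[a, b], continuous f} -> {within `[c, d], continuous f}.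
Proof.
move=> ac db; apply: continuous_subspaceW => x /=; rewrite !in_itv/= => /andP[cx xd].
by rewrite (le_trans ac cx) (le_trans xd db).
Qed.

Lemma Rintegral_itv_split (f : R -> R) (a b c : R) : a <= b -> b <= c ->
  {within `[a, c], continuous f} ->
  \int[mu]_(x in `[a, c]) f x =
  \int[mu]_(x in `[a, b]) f x + \int[mu]_(x in `[b, c]) f x.
Proof.
move=> ab bc cf; have itf := within_itv_integrable cf.
rewrite -(@Rintegral_itv_obnd_cbnd _ b (BRight c)).
  by rewrite -(@Rintegral_itvB _ f (BLeft a) (BRight c) b)// addrC subrK.
apply: integrableS itf => //= x /=; rewrite !in_itv/= => /andP[bx ->].
by rewrite (le_trans ab)// ltW.
Qed.

(** Freezes the factor [h] at a constant under a nonnegative weight. The weight is half of [gamma]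
    when a path is frozen, and 1 when a Riemann sum is compared with its integral. *)
Lemma Rintegral_weighted_near (f h : R -> R) (a b c w : R) :
  {within `[a, b], continuous f} -> {within `[a, b], continuous h} ->
  (forall x, x \in `[a, b] -> 0 <= f x) ->
  (forall x, x \in `[a, b] -> `|h x - c| <= w) ->
  `|\int[mu]_(x in `[a, b]) (f x * h x) - c * \int[mu]_(x in `[a, b]) f x|
    <= w * \int[mu]_(x in `[a, b]) f x.
Proof.
move=> cf ch f0 hw.
have cfh := within_itvM cf ch.
have cZ (k : R) := @within_itvZ k _ _ _ cf.
have iP := within_itv_integrable.
rewrite -!RintegralZl//; [|exact: iP..].
rewrite -RintegralB//; [|exact: iP..].
have cB : {within `[a, b], continuous (fun x => f x * h x - c * f x)}.
  by move=> x; apply: (@cvgB _ R^o); [exact: cfh|exact: cZ].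
apply: le_trans; first by apply: le_normr_Rintegral => //; exact: iP.
apply: le_Rintegral => //; [|exact: iP|].
  by apply: iP; exact: within_itv_norm cB.
move=> x abx; rewrite (_ : _ - _ = f x * (h x - c)); last by ring.
by rewrite normrM ger0_norm ?f0// mulrC ler_wpM2r ?f0 ?hw.
Qed.

Lemma Rintegral_itv_cst1 (a b : R) : a <= b -> \int[mu]_(x in `[a, b]) 1 = b - a.
Proof.
move=> ab; rewrite Rintegral_cst// mul1r.
have E : (mu `[a, b]%classic = (b - a)%:E)%E.
  rewrite lebesgue_measure_itv/= lte_fin.
  by move: ab; rewrite le_eqVlt => /predU1P[->|->//]; rewrite ltxx subrr.
by transitivity (fine (mu `[a, b]%classic)); [|rewrite E].
Qed.

(** The same expression as the nodes inside [ito_sum], so that the two are convertible. *)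
Definition grid (a b : R) (N k : nat) : R := a + k%:R * (b - a) / N.+1%:R.

Lemma grid0 a b N : grid a b N 0 = a.
Proof. by rewrite /grid mul0r mul0r addr0. Qed.

Lemma gridN a b N : grid a b N N.+1 = b.
Proof. by rewrite /grid mulrAC divff ?pnatr_eq0// mul1r addrC subrK. Qed.

Lemma gridS a b N k : grid a b N k.+1 = grid a b N k + (b - a) / N.+1%:R.
Proof. by rewrite /grid -addrA -!mulrA -[in LHS]natr1 mulrDl mul1r. Qed.

Lemma grid_le a b N j k : a <= b -> (j <= k)%N -> grid a b N j <= grid a b N k.
Proof.
move=> ab jk; rewrite /grid lerD2l ler_pM2r ?invr_gt0 ?ltr0n//.
by rewrite ler_wpM2r ?subr_ge0// ler_nat.
Qed.

Lemma grid_itv a b N k : a <= b -> (k <= N.+1)%N -> a <= grid a b N k <= b.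
Proof.
move=> ab kN; have := grid_le N ab (leq0n k); have := grid_le N ab kN.
by rewrite grid0 gridN => -> ->.
Qed.

Lemma Rintegral_grid (f : R -> R) (a b : R) (N : nat) : a <= b ->
  {within `[a, b], continuous f} ->
  \int[mu]_(x in `[a, b]) f x =
  \sum_(k < N.+1) \int[mu]_(x in `[grid a b N k, grid a b N k.+1]) f x.
Proof.
move=> ab cf.
have H m : (m <= N.+1)%N -> \int[mu]_(x in `[a, grid a b N m]) f x =
    \sum_(k < m) \int[mu]_(x in `[grid a b N k, grid a b N k.+1]) f x.
  elim: m => [|m IH] mN; first by rewrite big_ord0 grid0 set_itv1 Rintegral_set1.
  rewrite big_ord_recr/= -IH 1?ltnW//.
  have /andP[am _] := grid_itv ab (ltnW mN); have /andP[_ mb] := grid_itv ab mN.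
  apply: Rintegral_itv_split => //; first exact: grid_le.
  exact: within_itvS cf.
by rewrite -{1}(gridN a b N) H.
Qed.

(** The error is measured by the oscillation of [f] on the whole interval, for any number of nodes.
    It is applied on one small interval, whose inner nodes are chosen by an unrelated
    requirement. *)
Lemma Riemann_sum_near (f : R -> R) (a b w : R) (N : nat) : a <= b ->
  {within `[a, b], continuous f} ->
  (forall x y, x \in `[a, b] -> y \in `[a, b] -> `|f x - f y| <= w) ->
  `|\sum_(k < N.+1) f (grid a b N k) * ((b - a) / N.+1%:R)
    - \int[mu]_(x in `[a, b]) f x| <= w * (b - a).
Proof.
move=> ab cf fw; rewrite (Rintegral_grid N ab cf) -sumrB.
apply: (le_trans (ler_norm_sum _ _ _)).
rewrite (_ : w * (b - a) = \sum_(k < N.+1) w * ((b - a) / N.+1%:R)); last first.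
  rewrite sumr_const card_ord -mulr_natr; field.
  by rewrite addrC natr1 pnatr_eq0.
apply: ler_sum => k _.
have /andP[ak kb] := grid_itv ab (ltnW (ltn_ord k)).
have /andP[ak1 k1b] := grid_itv ab (ltn_ord k).
have kk1 : grid a b N k <= grid a b N k.+1 by exact: grid_le.
have c1 : {within `[grid a b N k, grid a b N k.+1], continuous (fun=> 1 : R)}.
  by move=> x; exact: cst_continuous.
have ck : {within `[grid a b N k, grid a b N k.+1], continuous f}.
  exact: within_itvS cf.
have := @Rintegral_weighted_near (fun=> 1) f _ _ (f (grid a b N k)) w c1 ck.
have len : grid a b N k.+1 - grid a b N k = (b - a) / N.+1%:R.
  by rewrite gridS addrAC subrr add0r.
rewrite Rintegral_itv_cst1// len distrC.
under eq_Rintegral do rewrite mul1r.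
apply => // x; rewrite in_itv/= => /andP[kx xk1].
by apply: fw; rewrite in_itv/= ?ak// (le_trans ak kx)/= (le_trans xk1 k1b).
Qed.

(** Both bounds come from [1 + u <= expR u], at [- z] and at [z]; the upper one also uses
    [(1 - z + z ^+ 2) * (1 + z) = 1 + z ^+ 3]. An error of second order per interval has a sum of
    the order of the mesh. *)
Lemma expRN_near (z : R) : 0 <= z -> 0 <= z - (1 - expR (- z)) <= z ^+ 2.
Proof.
move=> z0; have := expR_ge1Dx (- z); have := expR_ge1Dx z => h1 h2.
apply/andP; split; first lra.
suff : expR (- z) <= 1 - z + z ^+ 2 by lra.
rewrite expRN -div1r ler_pdivrMr ?expR_gt0//.
apply: (@le_trans _ _ ((1 - z + z ^+ 2) * (1 + z))); last first.
  by apply: ler_wpM2l => //; nra.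
rewrite (_ : _ * _ = 1 + z ^+ 3); last by ring.
by rewrite lerDl exprn_ge0.
Qed.

Lemma near_div_natr (c e : R) : 0 <= c -> 0 < e ->
  exists N0, forall N, (N0 <= N)%N -> c / N.+1%:R < e.
Proof.
move=> c0 e0; have ec : 0 < e / (c + 1) by rewrite divr_gt0// ltr_wpDl.
have [N0 _ H] := near_infty_natSinv_lt (PosNum ec).
exists N0 => N /H /=; rewrite ltr_pdivlMr ?ltr_wpDl// => H1.
apply: le_lt_trans H1; rewrite mulrC ler_wpM2l ?invr_ge0//.
by rewrite lerDl.
Qed.

End RealPaths.

(** * The integrating factor of the linear equation *)

Section OrnsteinUhlenbeckPath.
Context {R : realType}.
Local Notation mu := (@lebesgue_measure R).
Variables (gamma : R -> R) (t : R).
Hypotheses (cgamma : {within `[0, 1], continuous gamma})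
  (gamma_gt0 : forall s, s \in `[0, 1] -> 0 < gamma s)
  (t01 : t \in `]0, 1]).

Let G (s : R) := \int[mu]_(u in `[0, s]) gamma u.
Let dG (N k : nat) := \int[mu]_(u in `[grid 0 t N k, grid 0 t N k.+1]) gamma u.

Let t_gt0 : 0 < t. Proof. by move: t01; rewrite in_itv/= => /andP[]. Qed.
Let t_le1 : t <= 1. Proof. by move: t01; rewrite in_itv/= => /andP[]. Qed.

Lemma grid_in01 (N k : nat) : (k <= N.+1)%N -> grid 0 t N k \in `[0, 1].
Proof.
move=> kN; have /andP[h1 h2] := grid_itv (ltW t_gt0) kN.
by rewrite in_itv/= h1 (le_trans h2).
Qed.

Lemma grid_itv_sub01 (N k : nat) (u : R) : (k <= N)%N ->
  u \in `[grid 0 t N k, grid 0 t N k.+1] -> u \in `[0, 1].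
Proof.
move=> kN; rewrite !in_itv/= => /andP[h1 h2].
have /andP[h3 _] := grid_itv (ltW t_gt0) (leqW kN).
have /andP[_ h4] := grid_itv (ltW t_gt0) (kN : k.+1 <= N.+1)%N.
by rewrite (le_trans h3 h1) (le_trans h2) ?(le_trans h4).
Qed.

Lemma within_grid (f : R -> R) (N k : nat) : (k <= N)%N ->
  {within `[0, 1], continuous f} ->
  {within `[grid 0 t N k, grid 0 t N k.+1], continuous f}.
Proof.
move=> kN cf; apply: continuous_subspaceW cf => u; exact: grid_itv_sub01.
Qed.

Lemma int_gamma_grid (N k : nat) : (k <= N)%N ->
  G (grid 0 t N k.+1) = G (grid 0 t N k) + dG N k.
Proof.
move=> kN; apply: Rintegral_itv_split.
- by have /andP[] := grid_itv (ltW t_gt0) (leqW kN).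
- by apply: grid_le => //; exact: ltW.
- have /andP[_ h] := grid_itv (ltW t_gt0) (kN : k.+1 <= N.+1)%N.
  by apply: within_itvS cgamma => //; exact: le_trans t_le1.
Qed.

Lemma gridSB (N k : nat) : grid 0 t N k.+1 - grid 0 t N k = t / N.+1%:R.
Proof. by rewrite gridS subr0 addrAC subrr add0r. Qed.

Lemma dG_ge0 (N k : nat) : (k <= N)%N -> 0 <= dG N k.
Proof.
move=> kN; apply: Rintegral_ge0 => u uk; apply/ltW/gamma_gt0.
exact: grid_itv_sub01 uk.
Qed.

Lemma dG_le (M : R) (N k : nat) : (k <= N)%N ->
  (forall s, s \in `[0, 1] -> `|gamma s| <= M) -> dG N k <= M * (t / N.+1%:R).
Proof.
move=> kN HM; have kk : grid 0 t N k <= grid 0 t N k.+1 by apply: grid_le => //; exact: ltW.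
have c1 : {within `[grid 0 t N k, grid 0 t N k.+1], continuous (fun=> M : R)}.
  by move=> x; exact: cst_continuous.
have c2 : {within `[grid 0 t N k, grid 0 t N k.+1], continuous (fun=> 1 : R)}.
  by move=> x; exact: cst_continuous.
have iP := within_itv_integrable.
rewrite -(gridSB N k) -(Rintegral_itv_cst1 kk) -RintegralZl//; last exact: iP.
apply: le_Rintegral => //.
- by apply: iP; exact: within_grid.
- by apply: (iP _ (fun=> M * 1)); rewrite mulr1.
move=> u /= uk; rewrite mulr1; apply: le_trans (HM u _); first exact: ler_norm.
exact: grid_itv_sub01 uk.
Qed.

Lemma int_gamma_le (N k : nat) : (k <= N.+1)%N -> G (grid 0 t N k) <= G t.
Proof.
move=> kN; rewrite -{2}(gridN 0 t N).
have H m : (k + m <= N.+1)%N -> G (grid 0 t N k) <= G (grid 0 t N (k + m)).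
  elim: m => [|m IH]; first by rewrite addn0.
  rewrite addnS => kmN; rewrite int_gamma_grid//.
  by apply: (le_trans (IH (ltnW kmN))); rewrite lerDl dG_ge0.
by have := H (N.+1 - k)%N; rewrite subnKC//; apply.
Qed.

(** The integrating factor [expR (G / 2)] divided by its value at [t]: the weights are at most 1,
    the last one is 1, and the first one is the coefficient of the initial value. *)
Definition ou_weight (N k : nat) : R := expR ((G (grid 0 t N k) - G t) / 2).

Lemma ou_weight_gt0 N k : 0 < ou_weight N k.
Proof. exact: expR_gt0. Qed.

Lemma ou_weight_le1 N k : (k <= N.+1)%N -> ou_weight N k <= 1.
Proof.
move=> kN; rewrite -[leRHS]expR0 ler_expR.
by have := int_gamma_le kN; lra.
Qed.

Lemma ou_weight0 N : ou_weight N 0 = expR (- G t / 2).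
Proof. by rewrite /ou_weight grid0 /G set_itv1 Rintegral_set1 sub0r. Qed.

Lemma ou_weightN N : ou_weight N N.+1 = 1.
Proof. by rewrite /ou_weight gridN subrr mul0r expR0. Qed.

Lemma ou_weightS N k : (k <= N)%N ->
  ou_weight N k = ou_weight N k.+1 * expR (- (dG N k / 2)).
Proof.
by move=> kN; rewrite /ou_weight -expRD int_gamma_grid//; congr expR; field.
Qed.

(* Multiplying by the integrating factor [ou_weight], the drift cancels up to a
   term of second order in the mesh and the modulus of continuity of [x]. *)
Lemma ou_path_cvg (x : R -> R) (J : nat -> nat -> R) :
  {within `[0, 1], continuous x} ->
  (forall N k, (k <= N)%N -> x (grid 0 t N k.+1) = x (grid 0 t N k) +
    \int[mu]_(u in `[grid 0 t N k, grid 0 t N k.+1]) (- (2^-1 * gamma u) * x u)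
    + J N k) ->
  forall e : R, 0 < e -> exists N0, forall N, (N0 <= N)%N ->
    `|\sum_(k < N.+1) ou_weight N k.+1 * J N k - (x t - expR (- G t / 2) * x 0)| < e.
Proof.
move=> cx xJ e e0.
have [B B0 HB] := within_itv_bounded ler01 cx.
have [M M0 HM] := within_itv_bounded ler01 cgamma.
have Mt0 : 0 <= M * t by rewrite mulr_ge0// ltW.
(* Freezing the path costs at most [w * (M * t) / 2] in total, and the second-order terms
   [B * (M * t / 2) ^+ 2 / N.+1]; each is allotted half of [e]. The [+ 1] keeps the denominator
   positive when [M = 0]. *)
pose w := e / (M * t + 1).
have w0 : 0 < w by rewrite divr_gt0// ltr_wpDl.
have [r r0 Hr] := within_itv_unif_continuous cx w0.
have [N1 HN1] := near_div_natr (ltW t_gt0) r0.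
have c0 : 0 <= B * (M * t / 2) ^+ 2 by rewrite mulr_ge0// sqr_ge0.
have e20 : 0 < e / 2 by rewrite divr_gt0.
have [N2 HN2] := near_div_natr c0 e20.
exists (maxn N1 N2) => N; rewrite geq_max => /andP[/HN1 h1 /HN2 h2].
pose a k := ou_weight N k.
(* The limit is written as a telescoping sum, so that the estimate can be made interval by
   interval. *)
have -> : x t - expR (- G t / 2) * x 0 =
    \sum_(k < N.+1) (a k.+1 * x (grid 0 t N k.+1) - a k * x (grid 0 t N k)).
  rewrite -(big_mkord xpredT (fun k => a k.+1 * x (grid 0 t N k.+1) - a k * x (grid 0 t N k))).
  by rewrite telescope_sumr// /a ou_weightN mul1r gridN ou_weight0 grid0.
rewrite -sumrB.
have bnd (k : 'I_N.+1) : `|a k.+1 * J N k -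
    (a k.+1 * x (grid 0 t N k.+1) - a k * x (grid 0 t N k))| <=
    B * (M * (t / N.+1%:R) / 2) ^+ 2 + w * (M * (t / N.+1%:R) / 2).
  have kN : (k <= N)%N by rewrite -ltnS.
  set s := grid 0 t N k; set s' := grid 0 t N k.+1.
  have s01 : s \in `[0, 1] by apply: grid_in01; exact: leqW.
  set z := dG N k / 2.
  have z0 : 0 <= z by rewrite divr_ge0// dG_ge0.
  have zM : z <= M * (t / N.+1%:R) / 2 by rewrite ler_pM2r// dG_le.
  have cg := within_grid kN cgamma; have cxk := within_grid kN cx.
  have cg2 := @within_itvZ _ 2^-1 _ _ _ cg.
  have Iz : \int[mu]_(u in `[s, s']) (2^-1 * gamma u) = z.
    rewrite RintegralZl//; last exact: within_itv_integrable.
    by rewrite mulrC.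
  have cgx := within_itvM cg2 cxk.
  have := @Rintegral_weighted_near _ (fun u => 2^-1 * gamma u) x s s' (x s) w cg2 cxk.
  rewrite Iz; set I := \int[mu]_(_ in _) _ => HI.
  have {}HI : `|I - x s * z| <= w * z.
    apply: HI => u us; have u01 := grid_itv_sub01 kN us.
      by rewrite mulr_ge0// ltW// gamma_gt0.
    apply: Hr => //; rewrite ger0_norm; last first.
      by move: us; rewrite in_itv/= subr_ge0 => /andP[].
    apply: le_lt_trans h1; rewrite -(gridSB N k) lerD2r.
    by move: us; rewrite in_itv/= => /andP[].
  have JE : J N k = x s' - x s + I.
    rewrite (xJ N k kN) -/s -/s'.
    rewrite (_ : \int[mu]_(u in _) _ = - I); first by ring.
    rewrite /I -mulN1r -RintegralZl//; last exact: within_itv_integrable.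
    by apply: eq_Rintegral => u _; ring.
  rewrite /a (ou_weightS kN) -/z JE.
  (* The first term is the error of freezing the path at the left node, the second that of replacing
     [1 - expR (- z)] by [z]. *)
  rewrite (_ : _ - _ = ou_weight N k.+1 * ((I - x s * z) + x s * (z - (1 - expR (- z)))));
    last by ring.
  rewrite normrM gtr0_norm ?ou_weight_gt0//.
  apply: le_trans (ler_piMl _ (ou_weight_le1 (ltn_ord k))) _ => //.
  apply: le_trans (ler_normD _ _) _; rewrite addrC lerD//; last first.
    by apply: le_trans HI _; rewrite ler_wpM2l// ltW.
  have /andP[q1 q2] := expRN_near z0.
  rewrite normrM (ger0_norm q1) ler_pM ?HB//.
  by apply: le_trans q2 _; rewrite lerXn2r// nnegrE (le_trans z0).
apply: le_lt_trans (ler_norm_sum _ _ _) _.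
apply: le_lt_trans (ler_sum _ (fun k _ => bnd k)) _.
rewrite sumr_const card_ord -[ltLHS]mulr_natr.
have n0 : (N.+1%:R : R) != 0 by rewrite pnatr_eq0.
rewrite [ltLHS](_ : _ = B * (M * t / 2) ^+ 2 / N.+1%:R + w * (M * t) / 2); last first.
  by field.
rewrite [ltRHS]splitr; apply: ltr_leD => //.
rewrite ler_pM2r// /w mulrAC ler_pdivrMr ?ltr_wpDl//.
by rewrite ler_wpM2l ?lerDl// ltW.
Qed.

(** The limit is the integral of [gamma] times [expR (G - G t)], which is the derivative of the
    squared weight; hence the squares telescope to [1 - expR (- G t)]. The inner sizes [M] are
    quantified after [N0] because they are fixed later, interval by interval, by convergence in
    probability. *)
Lemma ou_variance_cvg (e : R) : 0 < e -> exists N0, forall N, (N0 <= N)%N ->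
  forall M : nat -> nat,
  `|\sum_(k < N.+1) ou_weight N k.+1 ^+ 2 *
      (\sum_(j < (M k).+1) gamma (grid (grid 0 t N k) (grid 0 t N k.+1) (M k) j) *
        ((grid 0 t N k.+1 - grid 0 t N k) / (M k).+1%:R))
    - (1 - expR (- G t))| < e.
Proof.
move=> e0.
have [M M0 HM] := within_itv_bounded ler01 cgamma.
have Mt0 : 0 <= M * t by rewrite mulr_ge0// ltW.
(* The errors of the inner Riemann sums add up to [w * t], half of [e]; the other half absorbs
   [(M * t) ^+ 2 / N.+1]. *)
pose w := e / (2 * t).
have w0 : 0 < w by rewrite divr_gt0// mulr_gt0.
have [r r0 Hr] := within_itv_unif_continuous cgamma w0.
have [N1 HN1] := near_div_natr (ltW t_gt0) r0.
have c0 : 0 <= (M * t) ^+ 2 by rewrite sqr_ge0.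
have e20 : 0 < e / 2 by rewrite divr_gt0.
have [N2 HN2] := near_div_natr c0 e20.
exists (maxn N1 N2) => N; rewrite geq_max => /andP[/HN1 h1 /HN2 h2] m.
pose a k := ou_weight N k.
have -> : 1 - expR (- G t) = \sum_(k < N.+1) (a k.+1 ^+ 2 - a k ^+ 2).
  rewrite -(big_mkord xpredT (fun k => a k.+1 ^+ 2 - a k ^+ 2)).
  rewrite telescope_sumr// /a ou_weightN ou_weight0 expr1n expr2 -expRD.
  by congr (_ - expR _); field.
rewrite -sumrB.
pose V k := \sum_(j < (m k).+1)
  gamma (grid (grid 0 t N k) (grid 0 t N k.+1) (m k) j) *
  ((grid 0 t N k.+1 - grid 0 t N k) / (m k).+1%:R).
have bnd (k : 'I_N.+1) : `|a k.+1 ^+ 2 * V k - (a k.+1 ^+ 2 - a k ^+ 2)| <=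
    w * (t / N.+1%:R) + (M * (t / N.+1%:R)) ^+ 2.
  have kN : (k <= N)%N by rewrite -ltnS.
  set s := grid 0 t N k; set s' := grid 0 t N k.+1.
  have ss' : s <= s' by apply: grid_le => //; exact: ltW.
  set z := dG N k.
  have z0 : 0 <= z by exact: dG_ge0.
  have zM : z <= M * (t / N.+1%:R) by exact: dG_le.
  have VI : `|V k - z| <= w * (t / N.+1%:R).
    rewrite -(gridSB N k); apply: Riemann_sum_near => //; first exact: within_grid.
    move=> x y xs ys; apply: Hr; [exact: grid_itv_sub01 xs|exact: grid_itv_sub01 ys|].
    apply: le_lt_trans h1; rewrite -(gridSB N k).
    move: xs ys; rewrite !in_itv/= => /andP[x1 x2] /andP[y1 y2].
    by rewrite ler_norml; apply/andP; split; lra.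
  rewrite /a (ou_weightS kN) -/z.
  rewrite (_ : _ - _ = ou_weight N k.+1 ^+ 2 * ((V k - z) + (z - (1 - expR (- z)))));
    last first.
    rewrite (_ : expR (- z) = expR (- (z / 2)) ^+ 2); last first.
      by rewrite expr2 -expRD; congr expR; field.
    by ring.
  rewrite normrM ger0_norm ?sqr_ge0//.
  have a1 : ou_weight N k.+1 ^+ 2 <= 1.
    by rewrite expr_le1 ?ou_weight_le1// ltW// ou_weight_gt0.
  apply: le_trans (ler_piMl _ a1) _ => //.
  apply: le_trans (ler_normD _ _) _; rewrite lerD//.
  have /andP[q1 q2] := expRN_near z0.
  rewrite (ger0_norm q1).
  by apply: le_trans q2 _; rewrite lerXn2r// nnegrE (le_trans z0).
apply: le_lt_trans (ler_norm_sum _ _ _) _.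
apply: le_lt_trans (ler_sum _ (fun k _ => bnd k)) _.
rewrite sumr_const card_ord -[ltLHS]mulr_natr.
have n0 : (N.+1%:R : R) != 0 by rewrite pnatr_eq0.
rewrite [ltLHS](_ : _ = e / 2 + (M * t) ^+ 2 / N.+1%:R); last first.
  have t0 : t != 0 by rewrite gt_eqF.
  by rewrite /w; field; rewrite t0 andbT addrC natr1.
by rewrite [ltRHS]splitr ler_ltD.
Qed.

End OrnsteinUhlenbeckPath.

(** * Ito sums of a deterministic integrand *)

Section GaussianIntegralSums.
Context {R : realType} {d} {T : measurableType d} (P : probability T R) (n : nat).
Local Open Scope ereal_scope.

Lemma gauss_law_scale (v c : R) (A : set 'rV[R]_n) : (0 < v)%R -> (0 < c)%R ->
  borel_rV A ->
  gauss_law (c ^+ 2 * v) A = gauss_law v ((fun x => c *: x)%R @^-1` A).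
Proof.
move=> v0 c0 mA; rewrite /gauss_law (@ge0_integral_rV_affine _ _ c 0%R)//.
- rewrite -ge0_integral_rVZl//.
  + apply: eq_integral_rV => x; rewrite addr0 -EFinM mulrA -gaussianZ//.
  + apply/measurable_EFinP; apply: measurable_funM.
      apply: (measurableT_comp (measurable_gaussian _ _)).
      by apply: measurable_rVD; [apply: measurable_rVZ; exact: measurable_id|exact: measurable_cst].
    apply: (measurable_indic_comp mA).
    by apply: measurable_rVD; [apply: measurable_rVZ; exact: measurable_id|exact: measurable_cst].
  + by move=> x; rewrite lee_fin mulr_ge0// gaussian_ge0.
  + by rewrite lee_fin exprn_ge0// ltW.
- by apply/measurable_EFinP; exact: (measurable_mul_indic (measurable_gaussian _ _) mA).
- by move=> x; rewrite lee_fin mulr_ge0// gaussian_ge0.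
Qed.

Lemma borel_rV_scale (c : R) (A : set 'rV[R]_n) : borel_rV A ->
  borel_rV ((fun x => c *: x)%R @^-1` A).
Proof.
move=> mA; rewrite -[_ @^-1` _]setTI.
exact: (@measurable_rVZ _ _ (borel R n) n c id (@measurable_id _ _ _) measurableT A mA).
Qed.

Lemma indep_gaussianZ (F1 F2 : set (set T)) (v c : R) (S : T -> 'rV[R]_n) :
  (0 < c)%R -> indep_gaussian P F1 F2 v S ->
  indep_gaussian P F1 F2 (c ^+ 2 * v) (fun w => c *: S w)%R.
Proof.
move=> c0 [v0 SF SP]; split; first by rewrite mulr_gt0// exprn_gt0.
  by move=> A mA; exact: (SF _ (borel_rV_scale c mA)).
move=> E A FE mA; rewrite gauss_law_scale//.
exact: (SP _ _ FE (borel_rV_scale c mA)).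
Qed.

Lemma indep_gaussian_ext (F1 F2 : set (set T)) (v v' : R) (S S' : T -> 'rV[R]_n) :
  v = v' -> S =1 S' -> indep_gaussian P F1 F2 v S -> indep_gaussian P F1 F2 v' S'.
Proof. by move=> <- /funext <-. Qed.

Variable F : R -> set (set T).
Hypothesis filF : filtration F.

(** Used at two levels: over the nodes inside one interval, which gives the law of an Ito sum, and
    over the intervals of the grid of [[0, t]]. *)
Lemma indep_gaussian_sum (tau v : nat -> R) (S : nat -> T -> 'rV[R]_n) (N : nat) :
  (forall k, (k <= N.+1)%N -> tau k \in `[0%R, 1%R]) ->
  (forall k, (k <= N)%N -> (tau k <= tau k.+1)%R) ->
  (forall k, (k <= N)%N -> indep_gaussian P (F (tau k)) (F (tau k.+1)) (v k) (S k)) ->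
  indep_gaussian P (F (tau 0%N)) (F (tau N.+1)) (\sum_(k < N.+1) v k)%R
    (fun w => \sum_(k < N.+1) S k w)%R.
Proof.
have [sF Fm Fle] := filF.
elim: N => [|N IH] tau01 tauS H.
  apply: indep_gaussian_ext (H 0%N _) => //; first by rewrite big_ord1.
  by move=> w; rewrite big_ord1.
have le0 k : (k <= N.+2)%N -> (tau 0%N <= tau k)%R.
  elim: k => // k IHk kN; apply: le_trans (IHk (ltnW kN)) (tauS _ _) => //.
have IH' := IH (fun k kN => tau01 k (leqW kN)) (fun k kN => tauS k (leqW kN))
  (fun k kN => H k (leqW kN)).
have a0 := tau01 0%N isT; have a1 := tau01 N.+1 (leqW (leqnn _)).
have a2 := tau01 N.+2 (leqnn _).
have := @indep_gaussianD _ _ _ P n _ _ _ _ _ _ _ (sF _ a1) (sF _ a2)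
  (Fle _ _ a0 a1 (le0 _ (leqW (leqnn _)))) (Fle _ _ a1 a2 (tauS _ (leqnn _)))
  (Fm _ a2) IH' (H _ (leqnn _)).
apply: indep_gaussian_ext; first by rewrite [RHS]big_ord_recr.
by move=> w; rewrite [RHS]big_ord_recr.
Qed.

Variable W : R -> T -> 'rV[R]_n.
Hypothesis wienerW : wiener P F W.

Lemma wiener_increment (s t : R) : s \in `[0%R, 1%R] -> t \in `[0%R, 1%R] -> (s < t)%R ->
  indep_gaussian P (F s) (F t) (t - s) (fun w => W t w - W s w)%R.
Proof.
move=> s01 t01 st; have [_ adW _ _ /(_ s t s01 t01 st) /= [[_ _ dW] iW]] := wienerW.
have [sF Fm Fle] := filF.
split; first by rewrite subr_gt0.
  apply/(sub_measurable_rVP _ (sF _ t01)).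
  rewrite (_ : (fun w => _) = (fun w => W t w + (-1) *: W s w)%R); last first.
    by apply/funext => w; rewrite scaleN1r.
  apply: measurable_rVD; first by apply/(sub_measurable_rVP _ (sF _ t01)) => A mA; exact: adW.
  apply: measurable_rVZ; apply/(sub_measurable_rVP _ (sF _ t01)) => A mA.
  by apply: (Fle _ _ s01 t01 (ltW st)); exact: adW.
by move=> E A FE mA; rewrite iW// dW.
Qed.

(** Each summand is an independent increment scaled by [g] at its left node. Positivity of [g] keeps
    the summands nondegenerate, as required by a law given through its density. *)
Lemma ito_sum_gaussian (g : R -> R) (s t : R) (N : nat) :
  s \in `[0%R, 1%R] -> t \in `[0%R, 1%R] -> (s < t)%R ->
  (forall u, u \in `[0%R, 1%R] -> (0 < g u)%R) ->
  indep_gaussian P (F s) (F t)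
    (\sum_(k < N.+1) g (grid s t N k) ^+ 2 * ((t - s) / N.+1%:R))%R
    (ito_sum g W s t N).
Proof.
move=> s01 t01 st g0.
have g01 k : (k <= N.+1)%N -> grid s t N k \in `[0%R, 1%R].
  move=> kN; have /andP[h1 h2] := grid_itv (ltW st) kN.
  move: s01 t01; rewrite !in_itv/= => /andP[s0 _] /andP[_ t1].
  by rewrite (le_trans s0 h1) (le_trans h2 t1).
have := @indep_gaussian_sum (grid s t N)
  (fun k => g (grid s t N k) ^+ 2 * ((t - s) / N.+1%:R))%R
  (fun k w => g (grid s t N k) *: (W (grid s t N k.+1) w - W (grid s t N k) w))%R N g01.
rewrite grid0 gridN; apply => k kN; first by apply: grid_le => //; exact: ltW.
have len : (grid s t N k.+1 - grid s t N k = (t - s) / N.+1%:R)%R.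
  by rewrite gridS addrAC subrr add0r.
apply: indep_gaussianZ; first by apply: g0; apply: g01; exact: leqW.
rewrite -len; apply: wiener_increment; [exact/g01/leqW|exact: g01|].
by rewrite -subr_gt0 len divr_gt0// subr_gt0.
Qed.

End GaussianIntegralSums.

(** * Convergence in probability and Gaussian tails *)

Section ConvergenceInProbability.
Context {R : realType} {d} {T : measurableType d} (P : probability T R).
Local Open Scope ereal_scope.

Lemma cvge0_eventually_le (u : nat -> \bar R) (e : R) : (0 < e)%R ->
  u @ \oo --> 0 -> exists N0, forall N, (N0 <= N)%N -> u N <= e%:E.
Proof.
move=> e0 /fine_cvgP[[N1 _ H1]] /cvgrPdist_lt /(_ e e0)[N2 _ H2].
exists (maxn N1 N2) => N; rewrite geq_max => /andP[/H1 fN /H2 /=].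
rewrite sub0r normrN => h; rewrite -(fineK fN) lee_fin.
by apply: le_trans (ltW h); exact: ler_norm.
Qed.

Lemma probability_bigU_le (B : nat -> set T) (m : nat) :
  (forall k, measurable (B k)) ->
  P (\big[setU/set0]_(k < m) B k) <= \sum_(k < m) P (B k).
Proof.
move=> mB; elim: m => [|m IH]; first by rewrite !big_ord0 measure0.
rewrite !big_ord_recr/=; apply: le_trans; last exact: leeD2r IH.
by apply: measureU2 => //; exact: bigsetU_measurable.
Qed.

(** The limit superior of the events [r <= f N] is negligible, and by finiteness of [P] the
    probabilities of their tail unions decrease to its probability. *)
Lemma ae_cvg_in_probability (f : nat -> T -> R) :
  (forall N, measurable_fun setT (f N)) ->
  {ae P, forall w, forall e : R, (0 < e)%R ->
    exists N0, forall N, (N0 <= N)%N -> (f N w < e)%R} ->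
  forall r e : R, (0 < r)%R -> (0 < e)%R ->
  exists N0, forall N, (N0 <= N)%N -> P [set w | (r <= f N w)%R] <= e%:E.
Proof.
move=> mf aef r e r0 e0; pose A N := [set w | (r <= f N w)%R].
have mA N : measurable (A N).
  by rewrite -[X in measurable X]setTI; apply: measurable_fun_le.
have mU N : measurable (\bigcup_(k >= N) A k) by apply: bigcup_measurable => k _; exact: mA.
have lim0 : P (lim_sup_set A) = 0.
  have mL : measurable (lim_sup_set A) by apply: bigcap_measurable => // k _; exact: mU.
  apply/(negligibleP _ mL); apply: negligibleS aef => w /= Aw H.
  have [N0 HN] := H r r0; have [k N0k] := Aw N0 Logic.I.
  by rewrite /A/= leNgt HN.
have Uoo : P (\bigcup_(k >= 0) A k) < +oo.
  by apply: le_lt_trans (probability_le1 P (mU 0%N)) _; rewrite ltry.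
have cU : P (\bigcup_(k >= N) A k) @[N --> \oo] --> 0.
  by rewrite -lim0; exact: lim_sup_set_cvg.
have [N0 HN] := cvge0_eventually_le e0 cU; exists N0 => N /HN; apply: le_trans.
apply: le_measure; [by rewrite inE; exact: mA|by rewrite inE; exact: mU|].
by move=> w Aw; exists N => /=.
Qed.

End ConvergenceInProbability.

Section GaussianTail.
Context {R : realType} (n : nat).
Local Open Scope ereal_scope.

Lemma borel_norm_ge (K : R) : borel_rV [set x : 'rV[R]_n | (K <= `|x|)%R].
Proof.
rewrite -[X in borel_rV X]setTI.
apply: (@measurable_fun_le _ (borel R n)) => //.
exact: continuous_borel_measurable (@norm_continuous R 'rV[R]_n).
Qed.

(** Continuity from above along the sets [k <= |x|], which decrease to the empty set. A scaling by a
    factor close to 1 moves a point little only where the point is bounded; this controls the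
    remaining event. *)
Lemma gauss_law_tail (v e : R) : (0 < v)%R -> (0 < e)%R ->
  exists2 K : R, (0 < K)%R & gauss_law v [set x : 'rV[R]_n | (K <= `|x|)%R] <= e%:E.
Proof.
move=> v0 e0; have mg := @measurable_gaussian R n 0 v.
pose nu := density_measure (lebesgue_rV n) mg (gaussian_ge0 0%R v).
have nuE B : borel_rV B -> nu B = gauss_law v B.
  move=> mB; rewrite /nu/= density_measureE// -integral_rVE//.
  - by apply/measurable_EFinP; exact: (measurable_mul_indic mg mB).
  - by move=> x; rewrite lee_fin mulr_ge0// gaussian_ge0.
pose F (k : nat) : set (borel R n) := [set x : 'rV[R]_n | (k%:R <= `|x|)%R].
have mF k : measurable (F k) by exact: borel_norm_ge.
have capF : \bigcap_k F k = set0.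
  rewrite -subset0 => x /= Fx; have := Fx (Num.truncn `|(x : 'rV[R]_n)|).+1 Logic.I.
  by rewrite /F/= leNgt truncnS_gt.
have := @nonincreasing_cvg_mu _ _ _ nu F.
rewrite capF measure0 => /(_ _ mF _ _)/(cvge0_eventually_le e0)[].
- change (nu (F 0%N) < +oo); rewrite nuE; last exact: mF.
  rewrite (_ : F 0%N = setT) ?gauss_lawT ?ltry//.
  by apply/seteqP; split => // x _; rewrite /F/= normr_ge0.
- exact: measurable0.
- move=> i j ij; apply/subsetPset => x; rewrite /F/=; apply: le_trans.
  by rewrite ler_nat.
move=> N0 /(_ N0.+1 (leqnSn _)) H; exists N0.+1%:R => //.
by rewrite -nuE//; exact: mF.
Qed.

End GaussianTail.

(** * The law of the forward diffusion *)

Section OrnsteinUhlenbeckLaw.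
Context {R : realType} {d} {T : measurableType d} (P : probability T R) (n : nat).
Local Notation mu := (@lebesgue_measure R).
Variables (gamma : R -> R) (F : R -> set (set T)) (W X : R -> T -> 'rV[R]_n) (t : R).
Hypotheses (cgamma : {within `[0, 1], continuous gamma})
  (gamma_gt0 : forall s, s \in `[0, 1] -> 0 < gamma s)
  (t01 : t \in `]0, 1]).

Let h := fun (x : 'rV[R]_n) (s : R) => (- (2^-1 * gamma s)) *: x.
Let g := fun s : R => Num.sqrt (gamma s).
Let G (s : R) := \int[mu]_(u in `[0, s]) gamma u.

Hypothesis sdeX : sde_solution P `[0, 1] F W h g X.

Let t_gt0 : 0 < t. Proof. by move: t01; rewrite in_itv/= => /andP[]. Qed.

Let int01 : (0 : R) \in `[0, 1]. Proof. by rewrite in_itv/= lexx ler01. Qed.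

Let t_in01 : t \in `[0, 1].
Proof. by move: t01; rewrite !in_itv/= => /andP[/ltW -> ->]. Qed.

Let measurable_X s : s \in `[0, 1] -> measurable_fun setT (X s : T -> borel R n).
Proof.
move=> s01; have [[[_ Fm _] _ _ _ _] adX _ _] := sdeX.
by move=> _ A mA; rewrite setTI; apply: (Fm s) => //; exact: adX.
Qed.

Let measurable_Y (c : R) :
  measurable_fun setT (fun w => X t w - c *: X 0 w : borel R n).
Proof.
rewrite (_ : (fun w => _) = (fun w => X t w + (-1) *: (c *: X 0 w))); last first.
  by apply/funext => w; rewrite scaleN1r.
apply: measurable_rVD; first exact: measurable_X.
by apply: measurable_rVZ; apply: measurable_rVZ; exact: measurable_X.
Qed.

Lemma within_coord (x : R -> 'rV[R]_n) (i : 'I_n) :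
  {within `[0, 1], continuous x} -> {within `[0, 1], continuous (fun u => x u 0 i)}.
Proof.
move=> cx u; apply: (@continuous_comp _ _ _ (x : subspace _ -> _) (fun y : 'rV[R]_n => y 0 i)).
  exact: cx.
exact: coord_continuous.
Qed.

Lemma normr_rV_lt (x : 'rV[R]_n) (e : R) : 0 < e ->
  (forall i, `|x 0 i| < e) -> `|x| < e.
Proof.
move=> e0 H; have : ball (0 : 'rV[R]_n) e x.
  split => // i j; rewrite /ball/= ord1 mxE sub0r normrN; exact: H.
by rewrite -ball_normE /= sub0r normrN.
Qed.

Local Notation tau := (grid 0 t).

Let ito_pieces : exists I : nat -> nat -> T -> 'rV[R]_n, forall N k,
  measurable_fun setT (I N k : T -> borel R n) /\
  ((k <= N)%N -> ito_integral P g W (tau N k) (tau N k.+1) (I N k) /\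
    {ae P, forall w, X (tau N k.+1) w = X (tau N k) w
      + \row_(i < n) \int[mu]_(u in `[tau N k, tau N k.+1]) (h (X u w) u 0 i)
      + I N k w}).
Proof.
suff : forall Nk : nat * nat, exists I : T -> 'rV[R]_n,
  measurable_fun setT (I : T -> borel R n) /\
  ((Nk.2 <= Nk.1)%N -> ito_integral P g W (tau Nk.1 Nk.2) (tau Nk.1 Nk.2.+1) I /\
    {ae P, forall w, X (tau Nk.1 Nk.2.+1) w = X (tau Nk.1 Nk.2) w
      + \row_(i < n) \int[mu]_(u in `[tau Nk.1 Nk.2, tau Nk.1 Nk.2.+1]) (h (X u w) u 0 i)
      + I w}).
  by move=> /choice[I HI]; exists (fun N k => I (N, k)) => N k; exact: (HI (N, k)).
(* Beyond the grid the piece is the constant 0, so that every member of the family is measurable. *)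
move=> [N k]/=; have [kN|Nk] := leqP k N; last first.
  by exists (fun=> 0); split => //; exact: measurable_cst.
have [_ _ _ H] := sdeX.
have s01 := grid_in01 t01 (leqW kN); have s'01 := grid_in01 t01 (kN : k.+1 <= N.+1)%N.
have ss' : tau N k <= tau N k.+1 by apply: grid_le => //; exact: ltW.
have [_ [I HI eI]] := H _ _ s01 s'01 ss'.
exists I; split => // _ A mA; rewrite setTI; exact: HI.1.
Qed.

(** The countably many almost sure equations hold on a common event of full probability. There each
    coordinate of a path is an instance of the deterministic [ou_path_cvg], and finitely many
    coordinates allow one rank. *)
Lemma ou_sum_cvg (I : nat -> nat -> T -> 'rV[R]_n) :
  (forall N k, (k <= N)%N -> {ae P, forall w, X (tau N k.+1) w = X (tau N k) w
      + \row_(i < n) \int[mu]_(u in `[tau N k, tau N k.+1]) (h (X u w) u 0 i)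
      + I N k w}) ->
  {ae P, forall w, forall e : R, 0 < e -> exists N0, forall N, (N0 <= N)%N ->
    `|\sum_(k < N.+1) ou_weight gamma t N k.+1 *: I N k w
      - (X t w - expR (- G t / 2) *: X 0 w)| < e}.
Proof.
move=> H; have [_ _ cX _] := sdeX.
have {}H : {ae P, forall w, forall N k, (k <= N)%N -> X (tau N k.+1) w = X (tau N k) w
      + \row_(i < n) \int[mu]_(u in `[tau N k, tau N k.+1]) (h (X u w) u 0 i)
      + I N k w}.
  apply: ae_foralln => N; apply: ae_foralln => k.
  have [kN|Nk] := leqP k N; last exact: aeW.
  by apply: filterS (H N k kN) => w Hw _.
apply: filterS2 H cX => w H cX e e0.
have /choice[N0 HN0] : forall i : 'I_n, exists N0, forall N, (N0 <= N)%N ->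
    `|\sum_(k < N.+1) ou_weight gamma t N k.+1 * (I N k w 0 i)
      - (X t w 0 i - expR (- G t / 2) * X 0 w 0 i)| < e.
  move=> i; apply: (@ou_path_cvg _ gamma t cgamma gamma_gt0 t01 (fun u => X u w 0 i)
    (fun N k => I N k w 0 i)) => //; first exact: within_coord.
  move=> N k kN; rewrite H// !mxE; congr (_ + _ + _).
  by apply: eq_Rintegral => u _; rewrite /h mxE.
exists (\max_(i < n) N0 i)%N => N maxN; apply: normr_rV_lt => // i.
have := HN0 i N (leq_trans (leq_bigmax i) maxN).
rewrite !mxE summxE; congr (`|_| < _); congr (_ - _).
by apply: eq_bigr => k _; rewrite mxE.
Qed.

Lemma sqrtr_near1 (x : R) : 0 <= x -> `|Num.sqrt x - 1| <= `|x - 1|.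
Proof.
move=> x0; rewrite -{2}(sqr_sqrtr x0) (_ : _ ^+ 2 - 1 = (Num.sqrt x - 1) * (Num.sqrt x + 1));
  last by ring.
rewrite normrM ler_peMr// ger0_norm ?addr_ge0 ?sqrtr_ge0//.
by rewrite lerDr sqrtr_ge0.
Qed.

Let v : R := 1 - expR (- G t).

Let G_gt0 : 0 < G t.
Proof.
have [c cin cmin] : exists2 c, c \in `[0, 1] & forall s, s \in `[0, 1] -> gamma c <= gamma s.
  exact: EVT_min.
have c1 : {within `[0, t], continuous (fun=> gamma c)}.
  by move=> x; exact: cst_continuous.
have cg : {within `[0, t], continuous gamma}.
  by apply: within_itvS cgamma => //; move: t01; rewrite in_itv/= => /andP[].
apply: (@lt_le_trans _ _ (\int[mu]_(u in `[0, t]) (gamma c * 1))).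
  rewrite RintegralZl//; last first.
    by apply: (@within_itv_integrable _ (fun=> 1)) => x; exact: cst_continuous.
  by rewrite Rintegral_itv_cst1 ?subr0 ?ltW// mulr_gt0 ?gamma_gt0.
apply: le_Rintegral => //.
- by apply: (@within_itv_integrable _ (fun=> gamma c * 1)); rewrite mulr1.
- exact: within_itv_integrable.
move=> u /= ut; rewrite mulr1; apply: cmin; move: ut t01; rewrite !in_itv/=.
by move=> /andP[-> ut] /andP[_]; exact: le_trans.
Qed.

Lemma ou_variance_gt0 : 0 < v.
Proof. by rewrite /v subr_gt0 -expR0 ltr_expR oppr_lt0. Qed.

(** The noise [Y] is approached through [V N], the weighted sum of Ito integrals; then [S'], with
    the integrals replaced by Ito sums; then [Sc], rescaled to variance exactly [v]. Each passage
    costs [r / 3] in size and [r / 3] in probability. *)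
Lemma ou_noise_law (E : set T) (A : set 'rV[R]_n) : F 0 E -> borel_rV A ->
  P (E `&` (fun w => X t w - expR (- G t / 2) *: X 0 w) @^-1` A) =
  (P E * gauss_law v A)%E.
Proof.
have [[filF _ _ _ _] _ _ _] := sdeX; have [sF Fm Fle] := filF.
have wW : wiener P F W by case: sdeX.
move=> FE mA; pose Y w := X t w - expR (- G t / 2) *: X 0 w.
apply: (@indep_gaussian_lim _ n _ _ P (F 0) (F t) v Y ou_variance_gt0 _ _ _ _ E A FE mA).
- exact: measurable_Y.
- exact: Fm.
- exact: Fm.
move=> r r0.
have v0 := ou_variance_gt0.
have r30 : 0 < r / 3 by rewrite divr_gt0.
have [K K0 HK] := gauss_law_tail n v0 r30.
have [I HI] := ito_pieces.
pose V N w := \sum_(k < N.+1) ou_weight gamma t N k.+1 *: I N k w.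
have mV N : measurable_fun setT (V N : T -> borel R n).
  apply: measurable_rV_sum => k; apply: measurable_rVZ.
  exact: (HI N k).1.
have mnorm (f f' : T -> 'rV[R]_n) : measurable_fun setT (f : T -> borel R n) ->
    measurable_fun setT (f' : T -> borel R n) ->
    measurable_fun setT (fun w => `|f w - f' w|).
  move=> mf mf'.
  apply: (measurableT_comp (continuous_borel_measurable (@norm_continuous R 'rV[R]_n))).
  rewrite (_ : (fun w => _) = (fun w => f w + (-1) *: f' w)); last first.
    by apply/funext => w; rewrite scaleN1r.
  by apply: measurable_rVD => //; exact: measurable_rVZ.
have mge (f : T -> R) (e : R) : measurable_fun setT f -> measurable [set w | e <= f w].
  by move=> mf; rewrite -[X in measurable X]setTI; apply: measurable_fun_le.
have mVY N : measurable_fun setT (fun w => `|V N w - Y w|).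
  by apply: mnorm => //; exact: measurable_Y.
have [N1 HN1] := ae_cvg_in_probability mVY
  (ou_sum_cvg (fun N k kN => ((HI N k).2 kN).2)) r30 r30.
(* The relative variance error that keeps the effect of rescaling below [r / 3] on vectors of norm
   less than [K]. *)
have e0 : 0 < v * (r / 3 / K) by rewrite mulr_gt0// divr_gt0.
have [N2 HN2] := ou_variance_cvg cgamma gamma_gt0 t01 e0.
pose N := maxn N1 N2.
have n0 : (0 : R) < N.+1%:R by [].
have rN0 : 0 < r / 3 / N.+1%:R by rewrite divr_gt0.
(* With [N] fixed, each interval gets its own number of inner nodes. The share [r / 3 / N.+1], both
   in size and in probability, adds up to [r / 3] over the grid. *)
have /choice[m Hm] : forall k, exists m, (k <= N)%N ->
    (P [set w | (r / 3 / N.+1%:R <=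
      norm2 (ito_sum g W (tau N k) (tau N k.+1) m w - I N k w))%R] <= (r / 3 / N.+1%:R)%:E)%E.
  move=> k; have [kN|Nk] := leqP k N; last by exists 0%N.
  have [[_ iI] _] := (HI N k).2 kN.
  have [m Hm] := cvge0_eventually_le rN0 (iI _ rN0).
  by exists m => _; exact: Hm.
pose S k := ito_sum g W (tau N k) (tau N k.+1) (m k).
pose a k := ou_weight gamma t N k.+1.
pose v' := \sum_(k < N.+1) a k ^+ 2 *
  (\sum_(j < (m k).+1) gamma (grid (tau N k) (tau N k.+1) (m k) j) *
    ((tau N k.+1 - tau N k) / (m k).+1%:R)).
have tauS k : tau N k < tau N k.+1.
  by rewrite -subr_gt0 gridSB divr_gt0.
have SG k : (k <= N)%N -> indep_gaussian P (F (tau N k)) (F (tau N k.+1))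
    (\sum_(j < (m k).+1) gamma (grid (tau N k) (tau N k.+1) (m k) j) *
    ((tau N k.+1 - tau N k) / (m k).+1%:R)) (S k).
  move=> kN; have s01 := grid_in01 t01 (leqW kN).
  have s'01 := grid_in01 t01 (kN : k.+1 <= N.+1)%N.
  have g0 u : u \in `[0, 1] -> 0 < g u by move=> u01; rewrite sqrtr_gt0 gamma_gt0.
  apply: indep_gaussian_ext (ito_sum_gaussian filF wW (m k) s01 s'01 (tauS k) g0) => //.
  apply: eq_bigr => j _; rewrite sqr_sqrtr// ltW// gamma_gt0//.
  have /andP[h1 h2] := grid_itv (ltW (tauS k)) (ltnW (ltn_ord j)).
  move: s01 s'01; rewrite !in_itv/= => /andP[q1 _] /andP[_ q2].
  by rewrite (le_trans q1 h1) (le_trans h2 q2).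
have S'G : indep_gaussian P (F 0) (F t) v' (fun w => \sum_(k < N.+1) a k *: S k w).
  have := @indep_gaussian_sum _ _ _ P n F filF (tau N) (fun k => a k ^+ 2 *
    (\sum_(j < (m k).+1) gamma (grid (tau N k) (tau N k.+1) (m k) j) *
    ((tau N k.+1 - tau N k) / (m k).+1%:R))) (fun k w => a k *: S k w) N.
  rewrite grid0 gridN; apply.
  - by move=> k kN; exact: grid_in01.
  - by move=> k _; exact: ltW.
  - by move=> k kN; apply: indep_gaussianZ; [exact: ou_weight_gt0|exact: SG].
have [v'0 _ _] := S'G.
pose c := Num.sqrt (v / v').
have c0 : 0 < c by rewrite sqrtr_gt0 divr_gt0.
pose Sc w := c *: \sum_(k < N.+1) a k *: S k w.
have ScG : indep_gaussian P (F 0) (F t) v Sc.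
  apply: indep_gaussian_ext (indep_gaussianZ c0 S'G) => //.
  rewrite sqr_sqrtr ?divr_ge0 ?ltW//; field; exact/lt0r_neq0.
exists Sc => //.
have mS k : (k <= N)%N -> measurable_fun setT (S k : T -> borel R n).
  move=> kN; have [_ SF _] := SG k kN => _ B mB; rewrite setTI.
  by apply: (Fm (tau N k.+1)); [exact: grid_in01|exact: SF].
have mSc : measurable_fun setT (Sc : T -> borel R n).
  have [_ SF _] := ScG => _ B mB; rewrite setTI.
  by apply: (Fm t) => //; exact: SF.
pose B k := if (k <= N)%N then [set w | r / 3 / N.+1%:R <= `|S k w - I N k w|] else set0.
have mB k : measurable (B k).
  rewrite /B; case: ifPn => // kN; apply: mge; apply: mnorm; first exact: mS.
  exact: (HI N k).1.
have PB k : (k <= N)%N -> (P (B k) <= (r / 3 / N.+1%:R)%:E)%E.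
  move=> kN; apply: le_trans (Hm k kN); rewrite /B kN.
  have mk : measurable_fun setT (fun w => norm2 (S k w - I N k w)).
    apply: (measurableT_comp (continuous_borel_measurable (@continuous_norm2 R n))).
    rewrite (_ : (fun w => _) = (fun w => S k w + (-1) *: I N k w)); last first.
      by apply/funext => w; rewrite scaleN1r.
    apply: measurable_rVD; [exact: mS|apply: measurable_rVZ; exact: (HI N k).1].
  apply: le_measure; rewrite ?inE.
  - by have := mB k; rewrite /B kN.
  - exact: mge.
  by move=> w /= /le_trans; apply; exact: ler_norm_norm2.
pose U1 := [set w | K <= `|Sc w|].
pose U2 := [set w | r / 3 <= `|V N w - Y w|].
pose U3 := \big[setU/set0]_(k < N.+1) B k.
have mU1 : measurable U1.
  apply: mge; apply: measurableT_comp mSc.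
  exact: (continuous_borel_measurable (@norm_continuous R 'rV[R]_n)).
have mU2 : measurable U2 by exact: mge.
have mU3 : measurable U3 by exact: bigsetU_measurable.
have PU1 : (P U1 <= (r / 3)%:E)%E.
  have [F0 FD _] := sF 0 int01.
  have F0T : F 0 setT by rewrite -(setD0 setT); exact: FD.
  have [_ _ SP] := ScG; have := SP setT _ F0T (@borel_norm_ge _ n K).
  by rewrite setTI probability_setT mul1e => ->.
have PU2 : (P U2 <= (r / 3)%:E)%E by apply: HN1; exact: leq_maxl.
have PU3 : (P U3 <= (r / 3)%:E)%E.
  apply: (le_trans (probability_bigU_le P N.+1 mB)).
  apply: (@le_trans _ _ (\sum_(k < N.+1) (r / 3 / N.+1%:R)%:E)%E).
    by apply: lee_sum => k _; apply: PB; rewrite -ltnS.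
  by rewrite sumEFin lee_fin sumr_const card_ord -[leLHS]mulr_natr divfK.
have sub : [set w | r <= `|Sc w - Y w|] `<=` U1 `|` U2 `|` U3.
  move=> w /= rw; apply: contrapT => /not_orP[/not_orP[n1 n2] n3].
  move: rw; apply/negP; rewrite -ltNge.
  have {}n1 : `|Sc w| < K by rewrite ltNge; apply/negP.
  have {}n2 : `|V N w - Y w| < r / 3 by rewrite ltNge; apply/negP.
  have {}n3 k : (k <= N)%N -> `|S k w - I N k w| < r / 3 / N.+1%:R.
    move=> kN; rewrite ltNge; apply/negP => Bk; apply: n3.
    rewrite /U3 -bigcup_mkord; exists k; first by rewrite /= ltnS.
    by rewrite /B kN.
  pose S' := \sum_(k < N.+1) a k *: S k w.
  have d1 : `|Sc w - S'| <= r / 3.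
    (* Expressed through [Sc], not [S']: the law of [Sc] is known exactly, so the bound [K] applies
       to it. *)
    have -> : Sc w - S' = (1 - c^-1) *: Sc w.
      by rewrite scalerBl scale1r /Sc scalerA mulVf ?scale1r// gt_eqF.
    have cV : c^-1 = Num.sqrt (v' / v) by rewrite /c -sqrtrV ?invf_div// divr_ge0 ?ltW.
    rewrite normrZ; apply: (@le_trans _ _ (r / 3 / K * K)); last first.
      by rewrite divfK// gt_eqF.
    apply: ler_pM => //; last exact: ltW.
    rewrite distrC cV.
    apply: le_trans (sqrtr_near1 _) _; first by rewrite divr_ge0 ?ltW.
    rewrite (_ : v' / v - 1 = (v' - v) / v); last by field; rewrite gt_eqF.
    rewrite normrM normfV (gtr0_norm v0) ler_pdivrMr// mulrC.
    by apply/ltW; apply: HN2; exact: leq_maxr.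
  have d2 : `|S' - V N w| <= r / 3.
    rewrite /S' /V -sumrB; apply: le_trans (ler_norm_sum _ _ _) _.
    apply: (@le_trans _ _ (\sum_(k < N.+1) r / 3 / N.+1%:R)); last first.
      by rewrite sumr_const card_ord -[leLHS]mulr_natr divfK// gt_eqF.
    apply: ler_sum => k _; rewrite -scalerBr normrZ.
    have kN : (k <= N)%N by rewrite -ltnS.
    rewrite gtr0_norm ?ou_weight_gt0//.
    apply: le_trans (ltW (n3 k kN)); rewrite ler_piMl//.
    exact: ou_weight_le1.
  rewrite (_ : Sc w - Y w = (Sc w - S') + (S' - V N w) + (V N w - Y w)); last first.
    by rewrite !subrKA.
  apply: le_lt_trans (ler_normD _ _) _.
  rewrite (_ : r = r / 3 + r / 3 + r / 3); last by field.
  by apply: ler_ltD => //; apply: le_trans (ler_normD _ _) _; exact: lerD.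
have mSY : measurable [set w | r <= `|Sc w - Y w|].
  by apply: mge; apply: mnorm => //; exact: measurable_Y.
apply: (@le_trans _ _ (P (U1 `|` U2 `|` U3))).
  apply: le_measure; rewrite ?inE//.
  by apply: measurableU => //; exact: measurableU.
apply: le_trans; first by apply: measureU2 => //; exact: measurableU.
rewrite (_ : r%:E = (r / 3)%:E + (r / 3)%:E + (r / 3)%:E)%E; last first.
  by rewrite -!EFinD; congr EFin; field.
by apply: leeD => //; apply: le_trans; [exact: measureU2|exact: leeD].
Qed.

End OrnsteinUhlenbeckLaw.

(** * Continuous densities *)

Section ContinuousDensity.
Context {R : realType}.

Lemma ball_continuous (m n : nat) (f : 'rV[R]_m -> 'rV[R]_n) :
  (forall x y (e : R), ball x e y -> ball (f x) e (f y)) -> continuous f.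
Proof.
move=> H x A /nbhs_ballP[e e0 He]; have : nbhs x (f @^-1` A); last exact.
by apply/nbhs_ballP; exists e => // y xy; apply: He; exact: H.
Qed.

Lemma continuous_lsubmx (m n : nat) : continuous (@lsubmx R 1 m n).
Proof. by apply: ball_continuous => x y e [e0 H]; split=> // i j; rewrite !mxE; exact: H. Qed.

Lemma continuous_rsubmx (m n : nat) : continuous (@rsubmx R 1 m n).
Proof. by apply: ball_continuous => x y e [e0 H]; split=> // i j; rewrite !mxE; exact: H. Qed.

(** A sup-norm ball is a cube, so its indicator is a product over the coordinates. *)
Lemma integral_ball (n : nat) (x : 'rV[R]_n) (r : R) : 0 < r ->
  integral_rV (fun z => (\1_(ball x r) z : R)%:E) = ((2 * r) ^+ n)%:E.
Proof.
move=> r0.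
rewrite (_ : (fun z => _) = fun z : 'rV[R]_n =>
    (\prod_(i < n) \1_(ball (x ord0 i) r) (z ord0 i))%:E); last first.
  apply/funext => z; congr EFin; rewrite indicE.
  have [xz|xz] := pselect (ball x r z).
    rewrite mem_set// big1// => i _; rewrite indicE mem_set//; exact: xz.2.
  rewrite memNset//.
  have [i xzi] : exists i, ~ ball (x ord0 i) r (z ord0 i).
    apply/existsNP => H; apply: xz; split=> // i j.
    by rewrite ord1; exact: H.
  by rewrite (bigD1 i)//= indicE memNset// mul0r.
have mb i : measurable (ball (x ord0 i) r : set R).
  by apply: open_measurable; exact: ball_open.
rewrite (@integral_rV_prod R n (fun i => \1_(ball (x ord0 i) r))).
- transitivity (\prod_(i < n) (2 * r)%:E)%E.
    apply: eq_bigr => i _.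
    transitivity (lebesgue_measure (ball (x ord0 i) r : set R)).
      by rewrite integral_indic ?setIT//; exact: mb.
    rewrite ball_itv lebesgue_measure_itv/= lte_fin ltrD2l gtrN// -EFinD.
    by congr EFin; ring.
  by rewrite prodEFin prodr_const card_ord.
- by move=> i; apply: measurable_indic; exact: mb.
- by move=> i z; rewrite indicE; case: (_ \in _).
Qed.

Lemma measurable_continuousE (n : nat) (f : 'rV[R]_n -> R) :
  continuous f -> measurable_fun setT (EFin \o f : borel R n -> \bar R).
Proof. by move=> cf; apply/measurable_EFinP; exact: continuous_borel_measurable. Qed.

Lemma borel_ball (n : nat) (x : 'rV[R]_n) (r : R) : 0 < r -> borel_rV (ball x r).
Proof. by move=> r0; apply: open_borel; exact: ball_open. Qed.

Lemma ge0_integral_rVD (n : nat) (f g : borel R n -> \bar R) :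
  measurable_fun setT f -> measurable_fun setT g ->
  (forall x, 0 <= f x)%E -> (forall x, 0 <= g x)%E ->
  integral_rV (fun x => f x + g x)%E = (integral_rV f + integral_rV g)%E.
Proof.
move=> mf mg f0 g0; rewrite !integral_rVE//.
- by rewrite ge0_integralD.
- exact: emeasurable_funD.
- by move=> x; exact: adde_ge0.
Qed.

Lemma ge0_le_integral_rV (n : nat) (f g : borel R n -> \bar R) :
  measurable_fun setT f -> measurable_fun setT g ->
  (forall x, 0 <= f x)%E -> (forall x, f x <= g x)%E ->
  (integral_rV f <= integral_rV g)%E.
Proof.
move=> mf mg f0 fg; have g0 x : (0 <= g x)%E by exact: le_trans (fg x).
by rewrite !integral_rVE//; exact: ge0_le_integral.
Qed.

Lemma integral_rV_gt0 (n : nat) (f : 'rV[R]_n -> R) (x : 'rV[R]_n) :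
  continuous f -> (forall y, 0 <= f y) -> 0 < f x ->
  (0 < integral_rV (fun y => (f y)%:E))%E.
Proof.
move=> cf f0 fx0; have e0 : 0 < f x / 2 by rewrite divr_gt0.
have /nbhs_ballP[r /= r0 Hr] := cvgr_gt _ (cf x) (f x / 2)
  (ltac:(by rewrite ltr_pdivrMr// ltr_pMr// ltr1n)).
apply: (@lt_le_trans _ _ (integral_rV (fun z => (f x / 2)%:E * (\1_(ball x r) z)%:E)))%E.
  rewrite ge0_integral_rVZl.
  - by rewrite integral_ball// -EFinM lte_fin mulr_gt0// exprn_gt0// mulr_gt0.
  - by apply/measurable_EFinP; apply: measurable_indic; exact: borel_ball.
  - by move=> y; rewrite lee_fin indicE; case: (_ \in _).
  - by rewrite lee_fin ltW.
apply: ge0_le_integral_rV.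
- apply: measurable_funeM; apply/measurable_EFinP; apply: measurable_indic.
  exact: borel_ball.
- exact: measurable_continuousE.
- by move=> y; rewrite -EFinM lee_fin mulr_ge0// ltW.
move=> y; rewrite -EFinM lee_fin indicE.
have [xy|xy] := pselect (ball x r y); last by rewrite memNset// mulr0.
by rewrite mem_set// mulr1 ltW//; exact: Hr.
Qed.

Section Unique.
Context {d} {T : measurableType d} (P : probability T R) (n : nat) (X : T -> 'rV[R]_n).
Hypothesis mX : measurable_fun setT (X : T -> borel R n).

(** Were [f x] larger than [g x], [f] would exceed [g] by some [e > 0] on a ball of positive volume,
    while both integrate there to the same probability. Finiteness of that probability gives the
    contradiction. *)
Lemma continuous_density_le (f g : 'rV[R]_n -> R) (x : 'rV[R]_n) :
  continuous_density P X f -> continuous_density P X g -> f x <= g x.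
Proof.
move=> [f0 cf Pf] [g0 cg Pg]; rewrite leNgt; apply/negP => gf.
pose e := (f x - g x) / 2.
have e0 : 0 < e by rewrite divr_gt0// subr_gt0.
have cfg : continuous (fun y => f y - g y).
  by move=> y; exact: (cvgB (cf y) (cg y)).
have ee : e < f x - g x by rewrite /e ltr_pdivrMr// ltr_pMr ?subr_gt0// ltr1n.
have : \forall y \near x, e < f y - g y by exact: cvgr_gt (cfg x) _ ee.
move=> /nbhs_ballP[r /= r0 Hr].
have mB := borel_ball x r0.
have := Pf _ mB; rewrite Pg//.
set I := integral_rV _ => If.
have Ioo : (I < +oo)%E.
  rewrite /I -Pg//; apply: le_lt_trans (probability_le1 P _) (ltry _).
  by rewrite -[_ @^-1` _]setTI; exact: (mX measurableT mB).
have I0 : (0 <= I)%E by apply: integral_rV_ge0 => y; rewrite lee_fin mulr_ge0.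
have mind : measurable_fun setT (\1_(ball x r) : borel R n -> R) by exact: measurable_indic.
have mg : measurable_fun setT (fun y : borel R n => (g y * \1_(ball x r) y)%:E).
  apply/measurable_EFinP; apply: measurable_funM => //; exact: continuous_borel_measurable.
have : (I + (e * (2 * r) ^+ n)%:E <= I)%E.
  have -> : ((e * (2 * r) ^+ n)%:E =
      integral_rV (fun y : borel R n => e%:E * (\1_(ball x r) y)%:E))%E.
    rewrite ge0_integral_rVZl ?integral_ball//; first exact/measurable_EFinP.
    by rewrite lee_fin ltW.
  have mI : measurable_fun setT (fun y : borel R n => e%:E * (\1_(ball x r) y)%:E)%E.
    by apply: measurable_funeM; exact/measurable_EFinP.
  have mI0 (y : borel R n) : (0 <= e%:E * (\1_(ball x r) y)%:E)%E.
    by rewrite -EFinM lee_fin mulr_ge0// ltW.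
  have mg0 (y : borel R n) : (0 <= (g y * \1_(ball x r) y)%:E)%E.
    by rewrite lee_fin mulr_ge0.
  rewrite {2}If /I -(ge0_integral_rVD mg mI mg0 mI0).
  apply: ge0_le_integral_rV.
  - by apply: emeasurable_funD => //; apply: measurable_funeM; exact/measurable_EFinP.
  - apply/measurable_EFinP; apply: measurable_funM => //; exact: continuous_borel_measurable.
  - by move=> y; rewrite -EFinM -EFinD lee_fin addr_ge0// mulr_ge0// ltW.
  move=> y; rewrite -EFinM -EFinD lee_fin indicE.
  have [xy|xy] := pselect (ball x r y); last by rewrite memNset// !mulr0 addr0.
  by rewrite mem_set// !mulr1; have := Hr _ xy; rewrite /=; lra.
rewrite -(fineK (_ : I \is a fin_num)) ?ge0_fin_numE// -EFinD lee_fin.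
by rewrite gerDl leNgt mulr_gt0// exprn_gt0// mulr_gt0.
Qed.

Lemma density_unique (f : 'rV[R]_n -> R) : continuous_density P X f ->
  density P X = f.
Proof.
move=> Pf; apply: xget_unique => // g Pg; apply/funext => x.
by apply/eqP; rewrite eq_le !continuous_density_le.
Qed.

End Unique.

(** Continuity is reduced to sequences because dominated convergence is a statement about
    sequences. *)
Lemma continuous_seq (n : nat) (f : 'rV[R]_n -> R) :
  (forall (x : 'rV[R]_n) (u : nat -> 'rV[R]_n), u @ \oo --> x -> f \o u @ \oo --> f x) ->
  continuous f.
Proof.
move=> H x A /nbhs_ballP[e e0 He].
suff : nbhs x [set y | `|f x - f y| < e] by apply: filterS => y /= xy; exact: He.
apply/nbhs_ballP; apply: contrapT => nH.
have /choice[u Hu] : forall k : nat, exists y, ball x k.+1%:R^-1 y /\ ~ (`|f x - f y| < e).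
  move=> k; apply: contrapT => nk; apply: nH; exists k.+1%:R^-1; first by rewrite /= invr_gt0.
  by move=> y xy; apply: contrapT => h; apply: nk; exists y.
have ux : u @ \oo --> x.
  move=> B /nbhs_ballP[r r0 Hr].
  apply: filterS (near_infty_natSinv_lt (PosNum r0)) => k /= kr.
  by apply: Hr; apply: le_ball (Hu k).1; exact: ltW.
have /cvgrPdist_lt/(_ e e0)[N _ HN] := H x u ux.
by case: (Hu N) => _; apply; exact: (HN N (leqnn N)).
Qed.

Lemma continuous_gaussian (n : nat) (m : 'rV[R]_n) (v : R) : continuous (gaussian m v).
Proof.
rewrite (_ : gaussian m v = gaussian 0 v \o (fun x => x - m)); last first.
  by apply/funext => x; rewrite /= gaussian_center.
have cB : continuous (fun x : 'rV[R]_n => x - m).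
  apply: ball_continuous => x y e [e0 xy]; split=> // i j; have := xy i j.
  by rewrite /ball/= !mxE opprB addrA subrK.
by move=> x; apply: continuous_comp; [exact: cB|exact: continuous_gaussian0].
Qed.

(* Dominated convergence: the Gaussian kernel is bounded by its maximum. *)
Lemma continuous_gaussian_mixture (n : nat) (p : 'rV[R]_n -> R) (c v : R) :
  0 < v -> continuous p -> probability_density p ->
  continuous (fun y : 'rV[R]_n =>
    fine (integral_rV (fun x => (p x * gaussian (c *: x) v y)%:E))).
Proof.
move=> v0 cp [p0 p1]; apply: continuous_seq => y u uy.
have mp := continuous_borel_measurable cp.
pose f_ k (x : borel R n) := (p x * gaussian (c *: x) v (u k))%:E.
pose f (x : borel R n) := (p x * gaussian (c *: x) v y)%:E.
pose M := (Num.sqrt ((2 * pi * v) ^+ n))^-1.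
have M0 : 0 <= M by rewrite invr_ge0 sqrtr_ge0.
have mgz z : measurable_fun setT (fun x : borel R n => (p x * gaussian (c *: x) v z)%:E).
  apply/measurable_EFinP; apply: measurable_funM => //.
  under eq_fun do rewrite gaussian_center.
  apply: (measurableT_comp (continuous_borel_measurable (@continuous_gaussian0 _ n v))).
  rewrite (_ : (fun x => _) = (fun x : borel R n => z + (- c) *: (x : 'rV[R]_n))); last first.
    by apply/funext => x; rewrite scaleNr.
  by apply: measurable_rVD; [exact: measurable_cst|apply: measurable_rVZ; exact: measurable_id].
have ge0 z x : (0 <= (p x * gaussian (c *: x) v z)%:E)%E by rewrite lee_fin mulr_ge0// gaussian_ge0.
have le z x : ((p x * gaussian (c *: x) v z)%:E <= M%:E * (p x)%:E)%E.
  by rewrite -EFinM lee_fin mulrC ler_wpM2r// gaussian_le.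
have iM : integral_rV (fun x => M%:E * (p x)%:E)%E = M%:E.
  rewrite ge0_integral_rVZl ?p1 ?mule1//; exact/measurable_EFinP.
have mM : measurable_fun setT (fun x : borel R n => M%:E * (p x)%:E)%E.
  by apply: measurable_funeM; exact/measurable_EFinP.
have fin z : integral_rV (fun x => (p x * gaussian (c *: x) v z)%:E) \is a fin_num.
  rewrite ge0_fin_numE; last exact: integral_rV_ge0.
  apply: (@le_lt_trans _ _ M%:E); last exact: ltry.
  by rewrite -iM; exact: ge0_le_integral_rV.
have E z : integral_rV (fun x => (p x * gaussian (c *: x) v z)%:E) =
  (\int[lebesgue_rV n]_x (p x * gaussian (c *: x) v z)%:E)%E by rewrite integral_rVE.
have ae_cvg : {ae lebesgue_rV n, forall x, setT x -> f_ ^~ x @ \oo --> f x}.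
  apply: aeW => x _; apply/fine_cvgP; split; first exact: nearW.
  apply: cvgM; first exact: cvg_cst.
  exact: (cvg_comp _ _ uy (@continuous_gaussian n (c *: x) v y)).
have int_p : (lebesgue_rV n).-integrable setT (fun x => M%:E * (p x)%:E)%E.
  apply/integrableP; split => //.
  have Mp0 x : (0 <= M%:E * (p x)%:E)%E by rewrite -EFinM lee_fin mulr_ge0.
  under eq_integral do rewrite gee0_abs//.
  by rewrite -integral_rVE// iM ltry.
have dom : {ae lebesgue_rV n, forall x k, setT x -> (`|f_ k x| <= M%:E * (p x)%:E)%E}.
  by apply: aeW => x k _; rewrite gee0_abs// ?le// ge0.
have [_ _ C] := dominated_convergence measurableT (fun k => mgz (u k)) (mgz y) ae_cvg int_p dom.
apply: fine_cvg; rewrite fineK//= E.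
by under eq_fun do rewrite E.
Qed.

End ContinuousDensity.

(** * Joint and conditional densities *)

Section ConditionalDensity.
Context {R : realType} (n : nat) (p : 'rV[R]_n -> R) (c v : R).
Hypotheses (v0 : 0 < v) (cp : continuous p) (dp : probability_density p).

Let p0 : forall x, 0 <= p x. Proof. by case: dp. Qed.

(** The joint density of the values at times 0 and [t], with [c] the square root of [alpha t] and
    [v = 1 - alpha t] in the application. It lives on pairs, where Tonelli's theorem applies;
    [ou_joint_density] is its transport to concatenated rows. *)
Definition ou_kernel (z : borel R n * borel R n) : R :=
  p z.1 * gaussian (c *: (z.1 : 'rV[R]_n)) v z.2.

Let kernel_ge0 z : 0 <= ou_kernel z.
Proof. by rewrite mulr_ge0// gaussian_ge0. Qed.

Lemma measurable_kernel : measurable_fun setT ou_kernel.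
Proof.
apply: measurable_funM.
  exact: (measurableT_comp (continuous_borel_measurable cp) measurable_fst).
rewrite (_ : (fun z => _) = fun z : borel R n * borel R n =>
    gaussian 0 v ((z.2 : 'rV[R]_n) + (- c) *: (z.1 : 'rV[R]_n))); last first.
  by apply/funext => z; rewrite gaussian_center scaleNr.
apply: (measurableT_comp (continuous_borel_measurable (@continuous_gaussian0 _ n v))).
by apply: measurable_rVD; [exact: measurable_snd|apply: measurable_rVZ; exact: measurable_fst].
Qed.

Lemma measurable_kernel1 (y : 'rV[R]_n) :
  measurable_fun setT (fun x : borel R n => (ou_kernel (x, y))%:E).
Proof.
by apply/measurable_EFinP; exact: (measurable_fun_pair1 (y : borel R n) measurable_kernel).
Qed.

Definition ou_joint_density (z : 'rV[R]_(n + n)) : R := ou_kernel (lsubmx z, rsubmx z).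

Lemma continuous_joint_density : continuous ou_joint_density.
Proof.
have cl : continuous (fun z : 'rV[R]_(n + n) => p (lsubmx z)).
  by move=> z; apply: continuous_comp; [exact: continuous_lsubmx|exact: cp].
have cd : continuous (fun z : 'rV[R]_(n + n) => rsubmx z - c *: lsubmx z).
  move=> z; apply: (@cvgB _ 'rV[R]_n _ (nbhs z) (nbhs_filter z)).
    exact: continuous_rsubmx.
  by apply: (@cvgZr _ 'rV[R]_n _ (nbhs z) (nbhs_filter z)); exact: continuous_lsubmx.
have cg : continuous (fun z : 'rV[R]_(n + n) => gaussian 0 v (rsubmx z - c *: lsubmx z)).
  by move=> z; exact: (continuous_comp (cd z) (@continuous_gaussian0 _ n v _)).
rewrite (_ : ou_joint_density = fun z => p (lsubmx z) *
    gaussian 0 v (rsubmx z - c *: lsubmx z)); last first.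
  by apply/funext => z; rewrite /ou_joint_density /ou_kernel/= gaussian_center.
by move=> z; apply: (cvgM (FF := nbhs_filter z)); [exact: cl|exact: cg].
Qed.

Definition ou_marginal_density (y : 'rV[R]_n) : R :=
  fine (integral_rV (fun x => (ou_kernel (x, y))%:E)).

Lemma ou_marginal_fin y : integral_rV (fun x => (ou_kernel (x, y))%:E) \is a fin_num.
Proof.
have mp := continuous_borel_measurable cp.
pose M := (Num.sqrt ((2 * pi * v) ^+ n))^-1.
rewrite ge0_fin_numE; last by apply: integral_rV_ge0 => x; rewrite lee_fin.
apply: (@le_lt_trans _ _ (integral_rV (fun x => M%:E * (p x)%:E)%E)).
  apply: ge0_le_integral_rV.
  - exact: measurable_kernel1.
  - by apply: measurable_funeM; exact/measurable_EFinP.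
  - by move=> x; rewrite lee_fin.
  - by move=> x; rewrite -EFinM lee_fin mulrC /ou_kernel ler_wpM2l// gaussian_le.
rewrite ge0_integral_rVZl//.
- by rewrite dp.2 mule1 ltry.
- exact/measurable_EFinP.
- by rewrite lee_fin invr_ge0 sqrtr_ge0.
Qed.

(** A density of integral 1 is positive somewhere; there the continuous integrand is positive too,
    hence so is its integral. *)
Lemma ou_marginal_gt0 y : 0 < ou_marginal_density y.
Proof.
apply: fine_gt0; apply/andP; split; last first.
  by have := ou_marginal_fin y; rewrite ge0_fin_numE//; apply: integral_rV_ge0 => x; rewrite lee_fin.
have [x px] : exists x, 0 < p x.
  apply: contrapT => /forallNP np.
  have pz x : p x = 0 by apply/eqP; rewrite eq_le p0 andbT leNgt; exact/negP.
  have := dp.2; rewrite (_ : (fun x => _) = cst 0%E); last first.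
    by apply/funext => x; rewrite pz.
  rewrite (@integral_rVE _ _ (cst 0%E))// integral0 => /eqP.
  by rewrite eq_sym onee_eq0.
apply: (@integral_rV_gt0 _ _ (fun x => ou_kernel (x, y)) x) => //.
  have cZ : continuous (fun x : 'rV[R]_n => y - c *: x).
    move=> z; apply: (@cvgB _ 'rV[R]_n _ (nbhs z) (nbhs_filter z)).
      exact: cst_continuous.
    by apply: (@cvgZr _ 'rV[R]_n _ (nbhs z) (nbhs_filter z)); exact: cvg_id.
  have cg : continuous (fun x : 'rV[R]_n => gaussian (c *: x) v y).
    under eq_fun do rewrite gaussian_center.
    by move=> z; exact: (continuous_comp (cZ z) (@continuous_gaussian0 _ n v _)).
  by move=> z; apply: (cvgM (FF := nbhs_filter z)); [exact: cp|exact: cg].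
by rewrite /ou_kernel/= mulr_gt0// gaussian_gt0.
Qed.

Section Law.
Context {d} {T : measurableType d} (P : probability T R) (Z0 Zt : T -> 'rV[R]_n).
Hypotheses (mZ0 : measurable_fun setT (Z0 : T -> borel R n))
  (mZt : measurable_fun setT (Zt : T -> borel R n)).
(** The law is prescribed on rectangles, the form in which equality of finite-dimensional laws
    carries it from one process to another. *)
Hypothesis rectP : forall A B, borel_rV A -> borel_rV B ->
  P (Z0 @^-1` A `&` Zt @^-1` B) =
  integral_rV (fun x => integral_rV (fun y => (ou_kernel (x, y) * (\1_A x * \1_B y))%:E)).

Let mZZ : measurable_fun setT (fun w => (Z0 w : borel R n, Zt w : borel R n)).
Proof. exact/measurable_fun_pairP. Qed.

Lemma ou_pair_law (C : set (borel R n * borel R n)) : measurable C ->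
  P [set w | C (Z0 w, Zt w)] =
  integral_rV (fun x => integral_rV (fun y => (ou_kernel (x, y) * \1_C (x, y))%:E)).
Proof.
move=> mC.
pose mu := measure_function_pushforward__canonical__measure_function_Measure P mZZ.
transitivity (mu C) => //.
apply: (joint_measure_unique measurable_kernel kernel_ge0) => //.
change (P ((fun w => (Z0 w, Zt w)) @^-1` setT) < +oo)%E.
by rewrite preimage_setT probability_setT ltry.
Qed.

Lemma ou_joint_continuous_density : continuous_density P (joint Z0 Zt) ou_joint_density.
Proof.
split; [by move=> z; exact: kernel_ge0|exact: continuous_joint_density|].
move=> A mA.
pose C : set (borel R n * borel R n) := [set z | A (row_mx (z.1 : 'rV[R]_n) z.2)].
have mC : measurable C.
  rewrite -[C]setTI.
  exact: (measurable_row_mx measurable_fst measurable_snd measurableT mA).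
transitivity (P [set w | C (Z0 w, Zt w)]) => //.
rewrite ou_pair_law// [RHS]integral_rV_row_mx; apply: eq_integral_rV => x.
apply: eq_integral_rV => y; rewrite /ou_joint_density row_mxKl row_mxKr.
by congr (_ * _)%:E.
Qed.

Lemma ou_marginal_continuous_density : continuous_density P Zt ou_marginal_density.
Proof.
split.
- by move=> y; exact: ltW (ou_marginal_gt0 y).
- exact: (@continuous_gaussian_mixture _ n p c v v0 cp dp).
move=> B mB; transitivity (P (Z0 @^-1` setT `&` Zt @^-1` B)).
  by rewrite preimage_setT setTI.
rewrite rectP//; last exact: (@measurableT _ (borel R n)).
have mf : measurable_fun setT (fun z : borel R n * borel R n =>
    (ou_kernel z * \1_B (z.2 : 'rV[R]_n))%:E).
  apply/measurable_EFinP; apply: measurable_funM; first exact: measurable_kernel.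
  exact: (measurable_indic_comp mB measurable_snd).
transitivity (integral_rV (fun x => integral_rV (fun y =>
    (ou_kernel (x, y) * \1_B y)%:E))).
  by apply: eq_integral_rV => x; apply: eq_integral_rV => y; rewrite indicT mul1r.
rewrite (integral_rV_swap mf); last by move=> z; rewrite lee_fin mulr_ge0.
apply: eq_integral_rV => y; rewrite EFinM (fineK (ou_marginal_fin y)) muleC.
rewrite -ge0_integral_rVZl.
- by apply: eq_integral_rV => x; rewrite -EFinM mulrC.
- exact: measurable_kernel1.
- by move=> x; rewrite lee_fin.
- by rewrite lee_fin.
Qed.

Lemma ou_cond_density (x y : 'rV[R]_n) :
  cond_density P Z0 Zt x y = p x * gaussian (c *: x) v y / ou_marginal_density y.
Proof.
have mJ : measurable_fun setT (joint Z0 Zt : T -> borel R (n + n)).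
  exact: measurable_row_mx.
rewrite /cond_density (density_unique mJ ou_joint_continuous_density).
rewrite (density_unique mZt ou_marginal_continuous_density).
by rewrite /ou_joint_density row_mxKl row_mxKr.
Qed.

End Law.

Section Transition.
Context {d} {T : measurableType d} (P : probability T R) (X0 Xt : T -> 'rV[R]_n).
Hypotheses (mX0 : measurable_fun setT (X0 : T -> borel R n))
  (mXt : measurable_fun setT (Xt : T -> borel R n)).
Hypothesis X0p : continuous_density P X0 p.
Hypothesis noise : forall A B, borel_rV A -> borel_rV B ->
  P (X0 @^-1` A `&` (fun w => Xt w - c *: X0 w) @^-1` B) =
  (P (X0 @^-1` A) * gauss_law v B)%E.

(** The pair of [X0] and the noise has a product density, and the pair [(X0, Xt)] is its image under
    the shear [(x, y) |-> (x, y + c *: x)]. Translating the inner integral by [c *: x] turns the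
    product into [ou_kernel]. *)
Lemma ou_rectangle_law (A B : set 'rV[R]_n) : borel_rV A -> borel_rV B ->
  P (X0 @^-1` A `&` Xt @^-1` B) =
  integral_rV (fun x => integral_rV (fun y => (ou_kernel (x, y) * (\1_A x * \1_B y))%:E)).
Proof.
move=> mA mB; pose Y w := Xt w - c *: X0 w.
have mY : measurable_fun setT (Y : T -> borel R n).
  rewrite (_ : Y = (fun w => Xt w + (- c) *: X0 w)); last first.
    by apply/funext => w; rewrite scaleNr.
  by apply: measurable_rVD => //; exact: measurable_rVZ.
have mXY : measurable_fun setT (fun w => (X0 w : borel R n, Y w : borel R n)).
  exact/measurable_fun_pairP.
pose mu := measure_function_pushforward__canonical__measure_function_Measure P mXY.
pose f (z : borel R n * borel R n) := p z.1 * gaussian 0 v (z.2 : 'rV[R]_n).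
have mp := continuous_borel_measurable cp.
have mf : measurable_fun setT f.
  apply: measurable_funM; first exact: (measurableT_comp mp measurable_fst).
  exact: (measurableT_comp (measurable_gaussian _ _) measurable_snd).
have f0 z : 0 <= f z by rewrite mulr_ge0// gaussian_ge0.
pose C : set (borel R n * borel R n) :=
  [set z | A z.1 /\ B ((z.2 : 'rV[R]_n) + c *: (z.1 : 'rV[R]_n))].
have mshift : measurable_fun setT (fun z : borel R n * borel R n =>
    (z.2 : 'rV[R]_n) + c *: (z.1 : 'rV[R]_n) : borel R n).
  by apply: measurable_rVD; [exact: measurable_snd|apply: measurable_rVZ; exact: measurable_fst].
have m1 : measurable_fun setT (fst : borel R n * borel R n -> borel R n).
  exact: measurable_fst.
have mC : measurable C.
  rewrite -[C]setTI.
  have -> : setT `&` C = (setT `&` fst @^-1` A) `&` (setT `&` (fun z : borel R n * borel R n =>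
      (z.2 : 'rV[R]_n) + c *: (z.1 : 'rV[R]_n) : borel R n) @^-1` B).
    by rewrite !setTI.
  by apply: measurableI; [exact: (m1 measurableT A mA)|exact: (mshift measurableT B mB)].
transitivity (mu C).
  congr (P _); apply/seteqP; split=> w /=.
    by move=> [Aw Bw]; split => //; rewrite /Y/= subrK.
  by move=> []; rewrite /Y/= subrK.
rewrite (joint_measure_unique mf f0)//.
- apply: eq_integral_rV => x.
  rewrite (@ge0_integral_rV_affine _ _ 1 (- (c *: x)))//.
  + rewrite expr1n mul1e; apply: eq_integral_rV => y.
    rewrite scale1r /f /ou_kernel/= -gaussian_center; congr (_ * _)%:E.
    rewrite !indicE -natrM mulnb; congr (nat_of_bool _)%:R.
    apply/idP/andP => [/set_mem[/= Ax]|[/set_mem Ax /set_mem By]].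
      by rewrite subrK => By; split; exact/mem_set.
    by apply/mem_set; rewrite /C/= subrK.
  + apply/measurable_EFinP; apply: measurable_funM.
      exact: (measurable_fun_pair2 (x : borel R n) mf).
    have mIC : measurable_fun setT (\1_C : borel R n * borel R n -> R).
      exact: measurable_indic.
    exact: (measurable_fun_pair2 (x : borel R n) mIC).
  + by move=> y; rewrite lee_fin mulr_ge0.
- change (P ((fun w => (X0 w, Y w)) @^-1` setT) < +oo)%E.
  by rewrite preimage_setT probability_setT ltry.
move=> A1 A2 mA1 mA2.
transitivity (P (X0 @^-1` A1 `&` Y @^-1` A2)) => //.
have [_ _ X0law] := X0p.
rewrite noise// X0law// -(@integral_rV_prod2 _ n n (fun x => p x * \1_A1 x)
  (fun y => gaussian 0 v (y : 'rV[R]_n) * \1_A2 y)).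
- by apply: eq_integral_rV => x; apply: eq_integral_rV => y; rewrite /f/= mulrACA.
- exact: (measurable_mul_indic mp mA1).
- exact: (measurable_mul_indic (measurable_gaussian _ _) mA2).
- by move=> x; rewrite mulr_ge0.
- by move=> y; rewrite mulr_ge0// gaussian_ge0.
Qed.
End Transition.

End ConditionalDensity.

(** * From the forward to the reverse process *)

Section SameLaw.
Context {R : realType} (n : nat).

Lemma norm2N (x : 'rV[R]_n) : norm2 (- x) = norm2 x.
Proof. by rewrite /norm2; under eq_bigr do rewrite mxE sqrrN. Qed.

Lemma same_law_pair {d} {T : measurableType d} (P : probability T R)
    {d'} {T' : measurableType d'} (P' : probability T' R)
    (X : R -> T -> 'rV[R]_n) (Y : R -> T' -> 'rV[R]_n) (s t : R) (A B : set 'rV[R]_n) :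
  same_law P X P' Y -> s \in `[0, 1] -> t \in `[0, 1] -> borel_rV A -> borel_rV B ->
  P' (Y s @^-1` A `&` Y t @^-1` B) = P (X s @^-1` A `&` X t @^-1` B).
Proof.
move=> XY s01 t01 mA mB.
pose u (i : 'I_2) := if i == ord0 then s else t.
pose C (i : 'I_2) := if i == ord0 then A else B.
have capE (U : Type) (Z : R -> U -> 'rV[R]_n) :
    \bigcap_(i in [set: 'I_2]) Z (u i) @^-1` C i = Z s @^-1` A `&` Z t @^-1` B.
  apply/seteqP; split=> w.
    by move=> H; split; [exact: (H ord0)|exact: (H (lift ord0 ord0))].
  by move=> [Aw Bw] i _; rewrite /u /C; case: ifPn.
by rewrite -!capE XY// => i; rewrite /u /C; case: ifPn.
Qed.

(** Adaptedness covers all of [[0, 1]] whatever the interval [J] of the equation; in particular it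
    covers the final instant of the reverse process, which lies outside [J]. *)
Lemma sde_solution_measurable {d} {T : measurableType d} (P : probability T R)
    (J : interval R) F W b g (X : R -> T -> 'rV[R]_n) (s : R) :
  sde_solution P J F W b g X -> s \in `[0, 1] ->
  measurable_fun setT (X s : T -> borel R n).
Proof.
move=> [[[_ Fm _] _ _ _ _] adX _ _] s01 _ A mA.
by rewrite setTI; apply: (Fm s) => //; exact: adX.
Qed.

End SameLaw.

Unset Implicit Arguments.
Set Strict Implicit.
Set Printing Implicit Defensive.

Theorem theorem3p1 (R : realType) (n : nat)
  (p : 'rV[R]_n -> R) (gamma : R -> R)
  (d : measure_display) (T : measurableType d) (P : probability T R)
  (F : R -> set (set T)) (W X : R -> T -> 'rV[R]_n)
  (d' : measure_display) (T' : measurableType d') (P' : probability T' R)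
  (G : R -> set (set T')) (Wb Xh : R -> T' -> 'rV[R]_n)
  (t : R) (xa : 'rV[R]_n) :
  let h := fun (x : 'rV[R]_n) (s : R) => (- (2^-1 * gamma s)) *: x in
  let g := fun s : R => Num.sqrt (gamma s) in
  let alpha := fun s : R =>
    expR (- \int[@lebesgue_measure R]_(u in `[0, s]) gamma u) in
  let sigma2 := (1 - alpha t) / alpha t in
  let xat := Num.sqrt (alpha t) *: xa in
  probability_density p -> C2 p -> finite_second_moment p ->
  {within `[0, 1], continuous gamma} ->
  (forall s, s \in `[0, 1] -> 0 < gamma s) ->
  regular_coefficients h g ->
  forward_process P p h g F W X ->
  reverse_process P h g X P' G Wb Xh ->
  t \in `]0, 1] ->
  [/\ has_density P' (joint (Xh 0) (Xh t)),
      has_density P' (Xh t),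
      0 < density P' (Xh t) xat &
      exists2 c : R, 0 < c & forall x : 'rV[R]_n,
        cond_density P' (Xh 0) (Xh t) x xat =
        c * (p x * (1 / Num.sqrt ((2 * pi * sigma2) ^+ n)
                    * expR (- norm2 (x - xa) ^+ 2 / (2 * sigma2)))) ].
Proof.
move=> h g alpha sigma2 xat dp _ _ cgamma gamma_gt0 _ [X0p sdeX] [sdeY XY] t01.
have z01 : (0 : R) \in `[0, 1] by rewrite in_itv/= lexx ler01.
have tin : t \in `[0, 1] by move: t01; rewrite !in_itv/= => /andP[/ltW -> ->].
have mX s (s01 : s \in `[0, 1]) := sde_solution_measurable sdeX s01.
have mXh s : s \in `[0, 1] -> measurable_fun setT (Xh s : T' -> borel R n).
  move=> s01; have s01' : 1 - s \in `[0, 1].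
    by move: s01; rewrite !in_itv/= => /andP[h0 h1]; apply/andP; split; lra.
  have := sde_solution_measurable sdeY s01'.
  by rewrite opprB addrC subrK.
pose a := \int[@lebesgue_measure R]_(u in `[0, t]) gamma u.
(* The square root of [alpha t], in the exponential form in which the integrating factor delivers
   it. *)
pose c := expR (- a / 2); pose v := 1 - expR (- a).
have c0 : 0 < c by exact: expR_gt0.
have v0 : 0 < v := ou_variance_gt0 cgamma gamma_gt0 t01.
have c2 : c ^+ 2 = alpha t by rewrite expr2 -expRD /alpha -/a; congr expR; field.
have sqc : Num.sqrt (alpha t) = c by rewrite -c2 sqrtr_sqr gtr0_norm.
have [_ cp _] := X0p.
have rectX A B : borel_rV A -> borel_rV B ->
    P (X 0 @^-1` A `&` X t @^-1` B) = integral_rV (fun x => integral_rV (fun y =>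
      (ou_kernel p c v (x, y) * (\1_A x * \1_B y))%:E)).
  move=> mA mB; apply: (ou_rectangle_law cp dp (mX _ z01) (mX _ tin) X0p) => //.
  (* The noise is independent of [F 0], which contains the event that [X 0] lies in [A1]. *)
  move=> A1 B1 mA1 mB1.
  apply: (ou_noise_law cgamma gamma_gt0 t01 sdeX) => //.
  by have [_ adX _ _] := sdeX; exact: adX.
have rectY A B : borel_rV A -> borel_rV B ->
    P' (Xh 0 @^-1` A `&` Xh t @^-1` B) = integral_rV (fun x => integral_rV (fun y =>
      (ou_kernel p c v (x, y) * (\1_A x * \1_B y))%:E)).
  by move=> mA mB; rewrite (same_law_pair XY)// rectX.
have mY0 := mXh _ z01; have mYt := mXh _ tin.
have Jd := ou_joint_continuous_density cp dp mY0 mYt rectY.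
have Md := ou_marginal_continuous_density v0 cp dp rectY.
split.
- by exists (ou_joint_density p c v).
- by exists (ou_marginal_density p c v).
- by rewrite (density_unique mYt Md) ou_marginal_gt0.
have q0 : 0 < ou_marginal_density p c v xat by exact: ou_marginal_gt0.
(* The denominator of Bayes' formula, times the Jacobian [c ^+ n] of the scaling that turns the
   variance [sigma2] into [v]. *)
exists ((c ^+ n)^-1 / ou_marginal_density p c v xat).
  by rewrite divr_gt0// invr_gt0 exprn_gt0.
move=> x; rewrite (ou_cond_density v0 cp dp mY0 mYt rectY).
have al0 : 0 < alpha t by exact: expR_gt0.
have vE : v = c ^+ 2 * sigma2.
  by rewrite c2 /sigma2 mulrC divfK ?gt_eqF.
have s20 : 0 < sigma2 by rewrite divr_gt0.
rewrite div1r; set w := (Num.sqrt _)^-1 * _.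
(* The Gaussian is even, so [x - xa] may be replaced by [xa - x]; scaling by [c] then gives
   [xat - c *: x]. *)
have -> : w = c ^+ n * gaussian (c *: x) v xat.
  transitivity (gaussian 0 sigma2 (xa - x)).
    by rewrite /gaussian subr0 -norm2N opprB.
  rewrite (gaussianZ _ s20 c0) -vE gaussian_center [in RHS]gaussian_center subr0.
  by rewrite /xat sqc scalerBr.
field.
by rewrite gt_eqF// gt_eqF// exprn_gt0.
Qed.
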